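(* Let $(V,q)$ be a finite dimensional graded Lie algebra, with $q$ of degree $0$, over a field of characteristic $0$, let $M$ be a finite dimensional graded $(V,q)$-module, and let $(\tilde V,\tilde b,\tilde q)$ be the double semi-direct product of $V$ by $M$, with associated symplectic form $\tilde B$ on $\tilde V[1]$. Let $\Phi:c\mapsto\tilde C$ be the map associating to any skewsymmetric multilinear mapping $c$ from $V^k$ into $M$, with degree $2-k$, the symmetric $\tilde B$-quadratic map $\tilde C$. Then $\Phi$ is a morphism from the Chevalley cohomology complex for the $(V,q)$-module $M$ to the Pinczon cohomology complex of symmetric forms $\mathcal C(\tilde V)|_S$ on $\tilde V$.
   Context: Grading and signs. For a graded space $U$, $|x|$ is the degree in $U$, and $U[1]$ is the same space with degree $\deg(x)=|x|-1$. Koszul's sign rule is used everywhere: each term in which graded letters appear in an order differing from that of the first term by a permutation carries the implicit sign of that permutation computed only on letters of odd degree (the degree $|\cdot|$ for formulas on $V,M,\tilde V$; the degree $\deg$ for formulas on shifted spaces). To a $k$-linear map $q$ on $U$ one associates the map on $U[1]$ (denoted by the capital letter, or by $[1]$) $Q(x_1,\ldots,x_k)=(-1)^{\sum_{j\le k}(k-j)\deg(x_j)}q(x_1,\ldots,x_k)$, of degree $|q|+k-1$; skewsymmetric $q$ corresponds to symmetric $Q$. Double semi-direct product. Write $q(x,y)=[x,y]$. $W=V\times M$ has Lie bracket $q_W((x,a),(y,b))=([x,y],x\cdot b-y\cdot a)$; its dual $W^\star=V^\star\times M^\star$ is a $W$-module by $(w\cdot f)(z)=f(q_W(z,w))$.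 $\tilde V=W\times W^\star=\{(x,a,g,h):x\in V,a\in M,g\in V^\star,h\in M^\star\}$, with Lie bracket $\tilde q((w,f),(w',f'))=(q_W(w,w'),w\cdot f'-w'\cdot f)$ and symmetric bilinear form $\tilde b((x,a,g,h),(x',a',g',h'))=g(x')+h(a')+g'(x)+h'(a)$. $(\tilde V,\tilde b,\tilde q)$ is a quadratic Lie algebra. $\tilde B(u,v)=(-1)^{\deg(u)}\tilde b(u,v)$ on $\tilde V[1]$, and $\tilde Q(u,v)=(-1)^{\deg(u)}\tilde q(u,v)$. Forms and brackets. $\mathcal C(\tilde V)$ is the space of multilinear forms on $\tilde V[1]$ invariant (with Koszul signs) under cyclic permutations of the arguments; $\Omega^{Cycl}$ is the sum of the images of an $n$-linear $\Omega$ under the cyclic group generated by $(1,\ldots,n)$; $\Omega^{Sym}$ is the sum of its images under $\mathfrak S_n$. The Pinczon bracket on $\mathcal C(\tilde V)$ associated to $\tilde b$ is $\{\Omega,\Omega'\}\tilde{\ }=\sum_i(\iota_{e_i}\Omega\otimes\iota_{e'_i}\Omega')^{Cycl}$, with $(e_i)$ a basis of $\tilde V$, $\tilde b(e_i,e'_j)=\delta_{ij}$, and $\iota_x$ insertion of $x$ in one slot. $\mathcal C(\tilde V)|_S$ is the space of totally symmetric forms, the quotient of $\mathcal C(\tilde V)$ by $\Omega\mapsto\Omega^{Sym}$, with induced bracket $\{\Omega^{Sym},(\Omega')^{Sym}\}\tilde{\ }|=(\{\Omega,\Omega'\}\tilde{\ })^{Sym}$. For a $k$-linear $R:\tilde V[1]^k\to\tilde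 V[1]$, $\Omega_R(u_1,\ldots,u_{k+1})=\tilde B(R(u_1,\ldots,u_k),u_{k+1})$; $R$ is $\tilde B$-quadratic if $\Omega_R$ is cyclic. $\tilde B$-quadratic symmetric maps $R$ are identified with the symmetric forms $\Omega_R$. Pinczon complex. The Pinczon coboundary operator $d_P$ on symmetric forms is the bracket with $\Omega_{\tilde Q}$; in terms of maps it is defined by $\{\Omega_{\tilde Q},\Omega_{\tilde C}\}\tilde{\ }|=\Omega_{d_P\tilde C}$. The map $\Phi$. For a skewsymmetric $k$-linear $c:V^k\to M$ of degree $2-k$, with shifted (symmetric) map $C$ of degree $1$, $$\tilde C((x_1,a_1,g_1,h_1),\ldots,(x_k,a_k,g_k,h_k))=\Big(0,C(x_1,\ldots,x_k),\sum_{j=1}^kC_j(x_1,\ldots,h_j,\ldots,x_k),0\Big),$$ where $C_j(x_1,\ldots,h_j,\ldots,x_k)(y)=h_j(C(x_{j+1},\ldots,x_k,y,x_1,\ldots,x_{j-1}))$. Equivalently $\Omega_{\tilde C}=(\Omega_{C'})^{Cycl}$ with $C'((x_i,a_i,g_i,h_i)_i)=(0,C(x_1,\ldots,x_k),0,0)$. $\tilde C$ is totally symmetric and $\tilde B$-quadratic. The Chevalley complex is the space of skewsymmetric multilinear maps from $V$ to $M$ with the usual Chevalley coboundary operator $d_{Ch}$ of the $V$-module $M$.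
   Formalization: With the stated normalizations Φ commutes with the coboundaries only up to a scalar: d_P Φ(c) = (-1)^{k+1}(k+2)/(3(k+1)) Φ(d_Ch c); Φ becomes a morphism after rescaling by nonzero constants depending only on k. Cochains of every degree are allowed. *)

(* Defs.v *)
From HB Require Import structures.
From mathcomp Require Import all_boot all_order all_algebra all_fingroup.

Set Implicit Arguments.
Unset Strict Implicit.
Unset Printing Implicit Defensive.

Import GRing.Theory.
Local Open Scope ring_scope.

(* A grading of a finite-dimensional space is given by the projections onto   *)
(* its homogeneous components; only the degrees in hdegs may contribute.      *)
Record grading (F : fieldType) (U : vectType F) := Grading {
  hcomp : int -> U -> U;
  hdegs : seq int;
  hcomp_linear : forall i, linear (hcomp i);
  hcompK : forall i j x, hcomp i (hcomp j x) = if i == j then hcomp i x else 0;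
  hdegs_uniq : uniq hdegs;
  hcomp_sum : forall x, \sum_(i <- hdegs) hcomp i x = x
}.

Definition homog (F : fieldType) (U : vectType F) (G : grading U) (i : int)
  (x : U) : Prop := hcomp G i x = x.

(* par G b x is the component of x of parity b for the degree |x|, and        *)
(* dpar G b x its component of parity b for the degree deg x = |x| - 1 of     *)
(* U[1].  Koszul signs only depend on parities, so that every graded formula  *)
(* below is extended multilinearly from homogeneous arguments by summing over *)
(* the parities of the arguments.                                             *)
Definition par (F : fieldType) (U : vectType F) (G : grading U) (b : bool)
  (x : U) : U := \sum_(i <- hdegs G | odd `|i|%N == b) hcomp G i x.

Definition dpar (F : fieldType) (U : vectType F) (G : grading U) (b : bool)
  (x : U) : U := par G (~~ b) x.

Section GradingTheory.
Variables (F : fieldType) (U : vectType F) (G : grading U).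

Lemma hcomp0 i : hcomp G i 0 = 0.
Proof. by have := hcomp_linear G i (-1) 0 0; rewrite !scaleN1r oppr0 addr0 addNr. Qed.

Lemma hcomp_out i x :
  i \notin hdegs G -> hcomp G i x = 0.
Proof.
move=> iN; rewrite -[x in LHS](hcomp_sum G).
have sumE (s : seq int) : i \notin s ->
    hcomp G i (\sum_(j <- s) hcomp G j x) = 0.
  elim: s => [|j s IHs]; first by rewrite big_nil hcomp0.
  rewrite inE negb_or => /andP[/negPf ij iNs].
  rewrite big_cons -[hcomp G j x]scale1r hcomp_linear hcompK ij scaler0 add0r.
  exact: IHs.
exact: sumE.
Qed.

Lemma hcomp_sum_sub (s : seq int) x :
  uniq s -> {subset hdegs G <= s} -> \sum_(i <- s) hcomp G i x = x.
Proof.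
move=> us sub; rewrite -[RHS](hcomp_sum G).
rewrite (bigID (mem (hdegs G))) /= [X in _ + X]big1; last first.
  by move=> i; apply: hcomp_out.
rewrite addr0 -big_filter; apply: perm_big; apply: uniq_perm.
- exact: filter_uniq.
- exact: hdegs_uniq.
by move=> i; rewrite mem_filter /=; case: (boolP (i \in hdegs G)) => // /sub ->.
Qed.
End GradingTheory.

Section ProdGrading.
Variables (F : fieldType) (U1 U2 : vectType F).
Variables (G1 : grading U1) (G2 : grading U2).

Let hc (i : int) (w : U1 * U2) : U1 * U2 := (hcomp G1 i w.1, hcomp G2 i w.2).
Let hd : seq int := undup (hdegs G1 ++ hdegs G2).

Fact prod_linear i : linear (hc i).
Proof.
by move=> a [x1 x2] [y1 y2]; rewrite /hc /= !hcomp_linear.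
Qed.

Fact prod_compK i j w : hc i (hc j w) = if i == j then hc i w else 0.
Proof. by rewrite /hc /= !hcompK; case: (i == j). Qed.

Fact prod_sum w : \sum_(i <- hd) hc i w = w.
Proof.
have E (s : seq int) : \sum_(i <- s) hc i w =
    (\sum_(i <- s) hcomp G1 i w.1, \sum_(i <- s) hcomp G2 i w.2).
  by elim: s => [|i s IHs]; rewrite ?big_nil // !big_cons IHs.
rewrite E !hcomp_sum_sub ?undup_uniq //; first by case: {E} w.
- by move=> i ?; rewrite mem_undup mem_cat orbC; apply/orP; left.
- by move=> i ?; rewrite mem_undup mem_cat; apply/orP; left.
Qed.

Definition prod_grading : grading (U1 * U2)%type :=
  Grading prod_linear prod_compK (undup_uniq _) prod_sum.
End ProdGrading.

Section DualGrading.
Variables (F : fieldType) (U : vectType F) (G : grading U).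

Let hcl (i : int) : 'End(U) := linfun (hcomp G i).

Fact hclE i x : hcl i x = hcomp G i x.
Proof.
pose L := GRing.isLinear.Build F U U *:%R (hcomp G i) (hcomp_linear G i).
pose f : {linear U -> U} := HB.pack (hcomp G i) L.
by rewrite /hcl -[hcomp G i]/(f : U -> U) lfunE.
Qed.

Let hc (i : int) (f : 'Hom(U, F^o)) : 'Hom(U, F^o) := (f \o hcl (- i))%VF.

Fact dual_linear i : linear (hc i).
Proof. by move=> a f g; rewrite /hc comp_lfunDl comp_lfunZl. Qed.

Fact dual_compK i j f : hc i (hc j f) = if i == j then hc i f else 0.
Proof.
apply/lfunP => x; rewrite /hc !comp_lfunE !hclE hcompK eqr_opp eq_sym.
case: eqVneq => [->|_]; first by rewrite comp_lfunE hclE.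
by rewrite linear0 zero_lfunE.
Qed.

Fact dual_uniq : uniq [seq - i | i <- hdegs G].
Proof. by rewrite map_inj_uniq ?hdegs_uniq //; apply: oppr_inj. Qed.

Fact dual_sum f : \sum_(i <- [seq - i | i <- hdegs G]) hc i f = f.
Proof.
apply/lfunP => x; rewrite sum_lfunE big_map -[in RHS](hcomp_sum G x) linear_sum.
by apply: eq_bigr => i _; rewrite comp_lfunE hclE opprK.
Qed.

Definition dual_grading : grading 'Hom(U, F^o) :=
  Grading dual_linear dual_compK dual_uniq dual_sum.
End DualGrading.

Section Multilinear.
Variables (F : fieldType) (U : vectType F) (G : grading U).

Definition upd n (u : {ffun 'I_n -> U}) (i : 'I_n) (x : U) : {ffun 'I_n -> U} :=
  [ffun j => if j == i then x else u j].

Definition multilinear (T : lmodType F) n (f : {ffun 'I_n -> U} -> T) : Prop :=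
  forall u i a x y,
    f (upd u i (a *: x + y)) = a *: f (upd u i x) + f (upd u i y).

Definition has_degree (T : vectType F) (GT : grading T) n
  (f : {ffun 'I_n -> U} -> T) (p : int) : Prop :=
  forall (d : 'I_n -> int) (u : {ffun 'I_n -> U}),
    (forall i, homog G (d i) (u i)) -> homog GT (\sum_i d i + p) (f u).

(* Degree p for the shifted degrees |x| - 1 of U[1] and T[1]. *)
Definition has_shifted_degree (T : vectType F) (GT : grading T) n
  (f : {ffun 'I_n -> U} -> T) (p : int) : Prop :=
  forall (d : 'I_n -> int) (u : {ffun 'I_n -> U}),
    (forall i, homog G (d i) (u i)) ->
    homog GT (\sum_i (d i - 1) + p + 1) (f u).

(* Exponent of the Koszul sign of (u_1, ..., u_n) |-> (u_(s 1), ..., u_(s n)) *)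
(* when u_i has parity e i.                                                   *)
Definition koszul n (s : 'S_n) (e : {ffun 'I_n -> bool}) : nat :=
  (\sum_(i < n) \sum_(j < n | i < j) [&& s j < s i, e (s i) & e (s j)])%N.

(* Image of f under s, with Koszul signs for the parity components P. *)
Definition pact (P : bool -> U -> U) (T : lmodType F) n (s : 'S_n)
  (f : {ffun 'I_n -> U} -> T) (u : {ffun 'I_n -> U}) : T :=
  \sum_(e : {ffun 'I_n -> bool})
    (-1) ^+ koszul s e *: f [ffun i => P (e (s i)) (u (s i))].

Definition skewsymmetric (T : lmodType F) n (f : {ffun 'I_n -> U} -> T) : Prop :=
  forall (s : 'S_n) u, (-1) ^+ odd_perm s *: pact (par G) s f u = f u.

Definition symmetric_shifted (T : lmodType F) n (f : {ffun 'I_n -> U} -> T)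
  : Prop := forall (s : 'S_n) u, pact (dpar G) s f u = f u.

Definition rot1 n : 'S_n := perm (@ordS_inj n).

Definition cyclic_form n (f : {ffun 'I_n -> U} -> F^o) : Prop :=
  forall u, pact (dpar G) (rot1 n) f u = f u.

Definition Cycl n (f : {ffun 'I_n -> U} -> F^o) (u : {ffun 'I_n -> U}) : F^o :=
  \sum_(s in <[rot1 n]>%g) pact (dpar G) s f u.

Definition Sym n (f : {ffun 'I_n -> U} -> F^o) (u : {ffun 'I_n -> U}) : F^o :=
  \sum_(s : 'S_n) pact (dpar G) s f u.

(* With indices starting at 0, (k - j) becomes (k - j.+1). *)
Definition shift (T : lmodType F) k (f : {ffun 'I_k -> U} -> T)
  (u : {ffun 'I_k -> U}) : T :=
  \sum_(e : {ffun 'I_k -> bool})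
    (-1) ^+ (\sum_(j < k) (k - j.+1) * e j)%N
      *: f [ffun j => dpar G (e j) (u j)].

Definition consf n (x : U) (u : {ffun 'I_n -> U}) : {ffun 'I_n.+1 -> U} :=
  [ffun i => oapp u x (unlift ord0 i)].

Definition snocf n (u : {ffun 'I_n -> U}) (x : U) : {ffun 'I_n.+1 -> U} :=
  [ffun i => oapp u x (unlift ord_max i)].

Definition initf n (u : {ffun 'I_n.+1 -> U}) : {ffun 'I_n -> U} :=
  [ffun i => u (lift ord_max i)].

(* The bracket of an n.+1-linear and an m.+1-linear form attached to a basis  *)
(* e and its dual basis e'.  The basis vectors are inserted in the last slot  *)
(* of f and the first slot of g, where they are adjacent.                     *)
Definition pbracket (N : nat) (e e' : N.-tuple U) n m
  (f : {ffun 'I_n.+1 -> U} -> F^o) (g : {ffun 'I_m.+1 -> U} -> F^o)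
  : {ffun 'I_(n + m) -> U} -> F^o :=
  Cycl (fun u => \sum_(i < N)
    f (snocf [ffun j => u (lshift m j)] (tnth e i)) *
    g (consf (tnth e' i) [ffun j => u (rshift n j)])).

(* The bracket induced on symmetric forms: since f = (f / n.+1!)^Sym and      *)
(* g = (g / m.+1!)^Sym for symmetric f and g, the rule                        *)
(*   {A^Sym, B^Sym}| = {A, B}^Sym                                             *)
(* is applied to A = f / n.+1! and B = g / m.+1!.                             *)
Definition sym_bracket (N : nat) (e e' : N.-tuple U) n m
  (f : {ffun 'I_n.+1 -> U} -> F^o) (g : {ffun 'I_m.+1 -> U} -> F^o)
  : {ffun 'I_(n + m) -> U} -> F^o :=
  Sym (pbracket e e' (fun u => (n.+1)`!%:R^-1 *: f u)
                     (fun u => (m.+1)`!%:R^-1 *: g u)).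
End Multilinear.

Section LieModule.
Variables (F : fieldType) (V M : vectType F) (GV : grading V) (GM : grading M).

Definition bilin (A B C : lmodType F) (f : A -> B -> C) : Prop :=
  (forall x, linear (f x)) /\ (forall y, linear (f ^~ y)).

Definition ksign (i j : int) : F := (-1) ^+ (odd `|i|%N && odd `|j|%N).

Record graded_lie (q : V -> V -> V) : Prop := GradedLie {
  lie_bilin : bilin q;
  lie_degree : forall i j x y,
    homog GV i x -> homog GV j y -> homog GV (i + j) (q x y);
  lie_skew : forall i j x y, homog GV i x -> homog GV j y ->
    q y x = - (ksign i j *: q x y);
  lie_jacobi : forall i j k x y z,
    homog GV i x -> homog GV j y -> homog GV k z ->
    q x (q y z) = q (q x y) z + ksign i j *: q y (q x z)
}.

Record graded_module (q : V -> V -> V) (act : V -> M -> M) : Prop :=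
  GradedModule {
  act_bilin : bilin act;
  act_degree : forall i j x m,
    homog GV i x -> homog GM j m -> homog GM (i + j) (act x m);
  act_bracket : forall i j x y m, homog GV i x -> homog GV j y ->
    act (q x y) m = act x (act y m) - ksign i j *: act y (act x m)
}.

Definition cochain k (p : int) (c : {ffun 'I_k -> V} -> M) : Prop :=
  [/\ multilinear c, skewsymmetric GV c & has_degree GV GM c p].

Variables (q : V -> V -> V) (act : V -> M -> M).

(* Chevalley coboundary of a cochain c of degree p.  On homogeneous arguments *)
(*   (d c)(x_1, ..., x_(k+1)) =                                               *)
(*      sum_i (-1)^(i+1) x_i . c(..., ^x_i, ...)                              *)
(*    + sum_(i<j) (-1)^(i+j) c([x_i, x_j], ..., ^x_i, ..., ^x_j, ...)         *)
(* with Koszul signs for the degree |.|, the letter c having degree p; the    *)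
(* exponents below are the same ones for indices starting at 0.               *)
Definition dCh (p : int) k (c : {ffun 'I_k -> V} -> M)
  (u : {ffun 'I_k.+1 -> V}) : M :=
  \sum_(e : {ffun 'I_k.+1 -> bool})
    (let v := [ffun i => par GV (e i) (u i)] in
    \sum_(i < k.+1)
      (-1) ^+ (i + e i * (odd `|p| + \sum_(l < k.+1 | l < i) e l))%N
        *: act (v i) (c [ffun l => v (lift i l)])
    + \sum_(i < k.+1) \sum_(j < k.+1 | (i < j)%N)
      (-1) ^+ (i + j + e i * (\sum_(l < k.+1 | l < i) e l)
                     + e j * (\sum_(l < k.+1 | (l < j) && (l != i)) e l))%N
        *: c [ffun l : 'I_k => nth 0
                (q (v i) (v j) ::
                 [seq v l | l <- enum 'I_k.+1 & (l != i) && (l != j)]) l]).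
End LieModule.

Section Double.
Variables (F : fieldType) (V M : vectType F) (GV : grading V) (GM : grading M).
Variables (q : V -> V -> V) (act : V -> M -> M).

Local Notation W := (V * M)%type.
Local Notation W' := ('Hom(V, F^o) * 'Hom(M, F^o))%type.

Definition dbl : vectType F := (W * W')%type.

Definition gradW : grading W := prod_grading GV GM.
Definition gradW' : grading W' := prod_grading (dual_grading GV) (dual_grading GM).
Definition graddbl : grading dbl := prod_grading gradW gradW'.

(* f y x with the Koszul sign of the exchange of the letters x and y *)
Definition kflip (A B : vectType F) (GA : grading A) (GB : grading B)
  (T : lmodType F) (f : B -> A -> T) (x : A) (y : B) : T :=
  \sum_(b : bool) \sum_(b' : bool)
    (-1) ^+ (b && b') *: f (par GB b' y) (par GA b x).

Definition bracketW (w w' : W) : W :=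
  (q w.1 w'.1, act w.1 w'.2 - kflip GM GV act w.2 w'.1).

Definition evW (f : W') (w : W) : F^o := f.1 w.1 + f.2 w.2.

(* (w . f)(z) = f([z, w]) with the sign of w f z |-> f z w *)
Definition coadj_fun (w : W) (f : W') (z : W) : F^o :=
  \sum_(b : bool) \sum_(b1 : bool) \sum_(b2 : bool)
    (-1) ^+ (b && (b1 (+) b2)) *:
      evW (par gradW' b1 f) (bracketW (par gradW b2 z) (par gradW b w)).

Definition coadj (w : W) (f : W') : W' :=
  (linfun (fun y : V => coadj_fun w f (y, 0)),
   linfun (fun a : M => coadj_fun w f (0, a))).

Definition bt (u v : dbl) : F^o :=
  evW u.2 v.1 + kflip gradW gradW' evW u.1 v.2.

Definition qt (u v : dbl) : dbl :=
  (bracketW u.1 v.1, coadj u.1 v.2 - kflip gradW' gradW coadj u.2 v.1).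

Definition Bt (u v : dbl) : F^o :=
  \sum_(b : bool) (-1) ^+ b *: bt (dpar graddbl b u) v.

Definition Qt : {ffun 'I_2 -> dbl} -> dbl :=
  shift graddbl (fun u : {ffun 'I_2 -> dbl} => qt (u ord0) (u ord_max)).

Definition Om k (R : {ffun 'I_k -> dbl} -> dbl) (u : {ffun 'I_k.+1 -> dbl})
  : F^o := Bt (R (initf u)) (u ord_max).

Definition quadratic k (R : {ffun 'I_k -> dbl} -> dbl) : Prop :=
  cyclic_form graddbl (Om R).

Section Phi.
Variables (k : nat) (c : {ffun 'I_k -> V} -> M).

Definition xpart (u : {ffun 'I_k -> dbl}) : {ffun 'I_k -> V} :=
  [ffun i => (u i).1.1].

Definition Cprime (u : {ffun 'I_k -> dbl}) : dbl :=
  ((0, shift GV c (xpart u)), 0).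

(* h_(k+1)(C(x_1, ..., x_k)) *)
Definition hC (v : {ffun 'I_k.+1 -> dbl}) : F^o :=
  (v ord_max).2.2 (shift GV c (xpart (initf v))).

(* sum_j C_j(x_1, ..., h_j, ..., x_k)(y), where C_j(...)(y) is                *)
(* h_j(C(x_(j+1), ..., x_k, y, x_1, ..., x_(j-1))) with the Koszul sign of    *)
(* (x_1, ..., h_j, ..., x_k, y) |-> (x_(j+1), ..., y, x_1, ..., x_(j-1), h_j) *)
(* times - (-1)^(deg y).  The latter comes from Bt: for a in M and y in V one *)
(* has Bt(a, h) = - h(a) and Bt(g, y) = (-1)^(deg y) g(y), so that it is the  *)
(* sign for which Om tildeC = Cycl (Om Cprime).                               *)
Definition gtilde (u : {ffun 'I_k -> dbl}) (y : V) : F^o :=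
  - (\sum_(b : bool) (-1) ^+ b *:
       (\sum_(j < k) pact (dpar graddbl) (rot1 k.+1 ^+ j.+1)%g hC
                         (snocf u ((dpar GV b y, 0), 0)))).

Definition tildeC (u : {ffun 'I_k -> dbl}) : dbl :=
  ((0, shift GV c (xpart u)), (linfun (gtilde u), 0)).

Definition Phi : {ffun 'I_k.+1 -> dbl} -> F^o := Om tildeC.
End Phi.

(* Bracket with Om Qt.  As f = (f / n!)^Sym for a symmetric n-linear form f,  *)
(* sym_bracket of symmetric n-linear and m-linear forms is (n + m - 2)/(n m)  *)
(* times the sum over shuffles of their contractions.  Hence, for a symmetric *)
(* quadratic k-linear R of shifted degree r,                                  *)
(*   dP (Om R) = (k + 2)/(3 (k + 1)) (-1)^r Om (Qt o R - (-1)^r R o Qt),      *)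
(* where o is the sum over shuffles of the insertions.  For R = tildeC c, the *)
(* shift signs make (-1)^r (Qt o R - (-1)^r R o Qt) equal to (-1)^(k + 1)     *)
(* times tildeC (dCh c), so that dP (Phi c) and Phi (dCh c) differ by the     *)
(* factor (-1)^(k + 1) (k + 2) / (3 (k + 1)).                                 *)
Definition dP (N : nat) (e e' : N.-tuple dbl) k
  (f : {ffun 'I_k.+1 -> dbl} -> F^o) : {ffun 'I_k.+2 -> dbl} -> F^o :=
  sym_bracket graddbl e e' (Om Qt) f.
End Double.

(* Main.v *)
(* Both sides are totally symmetric multilinear forms, so in characteristic 0 it
   is enough to compare their symmetrizations, and under the symmetrization any
   term may be replaced by its image under a permutation of the letters. Up to
   sign Phi c is the cyclic sum of h(C(x_1, ..., x_k)), where C is the shifted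
   cochain and h occupies the last place. Contracting the dual bases in the bracket
   with Om Qt substitutes [u_0, u_1] into a slot of Phi c. If this slot is the
   argument h, the result is equivalent to 2 h(x_0 . C(x_1, ...)); if it is one
   of the k other slots, to h(C([x_0, x_1], x_2, ...)). These are also the two
   kinds of terms of dCh c, all terms of one kind being equivalent, and only
   their multiplicities have to be counted. *)

Require Import Defs.
From HB Require Import structures.
From mathcomp Require Import all_boot all_order all_algebra all_fingroup.
From mathcomp Require Import ring.

Set Implicit Arguments.
Unset Strict Implicit.
Unset Printing Implicit Defensive.

Import GRing.Theory.
Local Open Scope ring_scope.

(** * Koszul signs *)

(** The formulas to be compared are sums over all parities of the letters, so their signs cannot be
    matched term by term. Every identity of multilinear maps is therefore tested on homogeneous
    letters ([multi_ext]), where a single parity pattern survives, and what remains is an identity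
    of booleans in which [addb] adds the exponents of signs. The final comparison rests on a
    proportionality. Let A and B be the symmetrizations of the action term and of the bracket term.
    The Pinczon side gives 2 (-1)^k A + k B, the Chevalley side (k + 1) A + (-1)^k (k (k + 1) / 2)
    B, and the second is (-1)^k (k + 1) / 2 times the first. Together with the factorials of
    [sym_bracket], the number k + 2 of rotations and the sign between [Phi] and [psi], this leaves
    the ratio (-1)^(k + 1) (k + 2) / (3 (k + 1)). As the ratio depends on k, a strict commutation
    with the coboundaries needs a rescaling in each arity, by the products of these ratios. *)

Definition permf (A : Type) n (s : 'S_n) (u : {ffun 'I_n -> A}) :
  {ffun 'I_n -> A} := [ffun i => u (s i)].

Definition liftf (A : Type) n (i : 'I_n.+1) (u : {ffun 'I_n.+1 -> A}) :
  {ffun 'I_n -> A} := [ffun j => u (lift i j)].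

Section Koszul.

Lemma odd_sum (I : finType) (P : pred I) (f : I -> nat) :
  odd (\sum_(i | P i) f i)%N = \big[addb/false]_(i | P i) odd (f i).
Proof. exact: (big_morph odd oddD). Qed.

Lemma mulb_addl (b : bool) (I : finType) (P : pred I) (f : I -> bool) :
  b && \big[addb/false]_(i | P i) f i = \big[addb/false]_(i | P i) (b && f i).
Proof. by apply: (big_morph (andb b)) => [x y|]; rewrite ?andb_addr ?andbF. Qed.

Definition kz n (s : 'S_n) (e : {ffun 'I_n -> bool}) : bool := odd (koszul s e).

(* The crossing test is written so as to be symmetric in the two letters. *)
Lemma kz_pairE n (s : 'S_n) (e : {ffun 'I_n -> bool}) :
  kz s e = \big[addb/false]_(p : 'I_n * 'I_n | (p.1 < p.2)%N)
    [&& (p.1 < p.2)%N (+) (s p.1 < s p.2)%N, e (s p.1) & e (s p.2)].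
Proof.
rewrite /kz /koszul odd_sum.
under eq_bigr do rewrite odd_sum.
rewrite pair_big_dep /=; apply: eq_bigr => -[i j] /= ij.
have nij : s i != s j by rewrite (inj_eq perm_inj); apply: contraTneq ij => ->; rewrite ltnn.
rewrite oddb ij /=; congr (_ && _).
by case: (ltngtP (s i) (s j)) nij => //= /val_inj ->; rewrite eqxx.
Qed.

(** A permutation maps unordered pairs bijectively to unordered pairs; where [t] reverses the order,
    the symmetry of [g] restores it. *)
Lemma big_sym_pairs (R : Type) (x : R) (op : Monoid.com_law x) n (t : 'S_n)
  (g : 'I_n -> 'I_n -> R) :
  (forall i j, i != j -> g i j = g j i) ->
  \big[op/x]_(p : 'I_n * 'I_n | (p.1 < p.2)%N) g (t p.1) (t p.2)
  = \big[op/x]_(p : 'I_n * 'I_n | (p.1 < p.2)%N) g p.1 p.2.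
Proof.
move=> gC.
pose sw (p : 'I_n * 'I_n) := (p.2, p.1).
have swK : cancel sw sw by case.
pose T (p : 'I_n * 'I_n) := (t p.1, t p.2).
have TK : cancel T (fun p => ((t^-1)%g p.1, (t^-1)%g p.2)) by case=> a b; rewrite /T /= !permK.
rewrite [RHS](bigID (fun p : 'I_n * 'I_n => ((t^-1)%g p.1 < (t^-1)%g p.2)%N)) /=.
rewrite [LHS](bigID (fun p : 'I_n * 'I_n => (t p.1 < t p.2)%N)) /=.
congr (op _ _).
  rewrite [RHS](reindex_inj (can_inj TK)) /=.
  by apply: eq_bigl => -[i j] /=; rewrite !permK andbC.
rewrite [RHS](reindex_inj (can_inj swK)) /= [RHS](reindex_inj (can_inj TK)) /=.
have E (p : 'I_n * 'I_n) : (t p.2 < t p.1)%N && ~~ (p.2 < p.1)%N =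
    (p.1 < p.2)%N && ~~ (t p.1 < t p.2)%N.
  case: p => i j /=; case: (eqVneq i j) => [->|ij]; first by rewrite !ltnn.
  have tij : (t i : nat) != t j by apply: contra ij => /eqP /val_inj /perm_inj ->.
  have {}ij : (i : nat) != j by apply: contra ij => /eqP /val_inj ->.
  by case: (ltngtP (t i) (t j)) tij => //; case: (ltngtP i j) ij.
apply: eq_big => [p|[i j] /=]; first by rewrite !permK E.
move=> /andP[ij _]; apply: gC; rewrite (inj_eq perm_inj).
by apply: contraTneq ij => ->; rewrite ltnn.
Qed.

(** Once [kz s] is reindexed by [t], its crossing tests telescope with those of [kz t]: a pair is
    crossed by the product exactly when one of the two factors crosses it. This cocycle identity
    makes [pact] an action. *)
Lemma kzM n (s t : 'S_n) (e : {ffun 'I_n -> bool}) :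
  kz (t * s)%g e = kz t (permf s e) (+) kz s e.
Proof.
rewrite !kz_pairE.
rewrite -[X in _ (+) X](@big_sym_pairs _ _ _ _ t
   (fun i j => [&& (i < j)%N (+) (s i < s j)%N, e (s i) & e (s j)])); last first.
  move=> i j ij; have sij : s i != s j by rewrite (inj_eq perm_inj).
  rewrite -!val_eqE /= in ij sij; rewrite [e (s j) && _]andbC; congr (_ && _).
  by case: (ltngtP i j) ij; case: (ltngtP (s i) (s j)) sij.
rewrite -big_split; apply: eq_bigr => -[i j] /= ij.
rewrite !ffunE !permM; rewrite -andb_addl.
by case: (_ < _)%N; case: (_ < _)%N; case: (_ < _)%N; case: (e _); case: (e _).
Qed.

Lemma kz1 n (e : {ffun 'I_n -> bool}) : kz 1 e = false.
Proof.
by rewrite kz_pairE big1 // => -[i j] /= ij; rewrite !perm1 ij.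
Qed.

(* The exponent in the definition of shift. *)
Definition wt n (e : {ffun 'I_n -> bool}) : bool :=
  odd (\sum_(j < n) (n - j.+1) * e j)%N.

(* The parity of the letters that i crosses when it is moved to the front. *)
Definition below n (e : {ffun 'I_n -> bool}) (i : nat) : bool :=
  \big[addb/false]_(l < n | (l < i)%N) e l.

Definition btot n (e : {ffun 'I_n -> bool}) : bool := \big[addb/false]_l e l.

Lemma lift_lt n (i : 'I_n.+1) (l : 'I_n) : (lift i l < i)%N = (l < i)%N.
Proof.
rewrite /= /bump; case: (leqP i l) => [il|li]; last by rewrite li.
by rewrite add1n ltnNge leqW ?il.
Qed.

Lemma lt_lift n (i : 'I_n.+1) (l : 'I_n) : (i < lift i l)%N = (i <= l)%N.
Proof.
by rewrite /= /bump; case: (leqP i l) => [il|li] /=; rewrite ?ltnS // ltnNge ltnW.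
Qed.

Lemma below_lift n (e : {ffun 'I_n.+1 -> bool}) (i : 'I_n.+1) :
  below (liftf i e) i = below e i.
Proof.
rewrite /below [RHS]big_mkcond (bigD1_ord i) //= ltnn /= [LHS]big_mkcond.
by apply: eq_bigr => l _; rewrite ffunE -lift_lt.
Qed.

Lemma below_perm_lift n (e : {ffun 'I_n.+1 -> bool}) (i : 'I_n.+1) (s : 'S_n) :
  \big[addb/false]_l [&& (lift i (s l) < i)%N, e i & e (lift i (s l))]
  = e i && below e i.
Proof.
rewrite -below_lift /below mulb_addl [RHS]big_mkcond [RHS](reindex_inj (@perm_inj _ s)) /=.
by apply: eq_bigr => l _; rewrite ffunE lift_lt; case: ltnP.
Qed.

(** Letter [j] comes to the front across the letters before it; the others keep their relative order
    under [lift] and are then permuted by [s]. *)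
Lemma kz_lift0 n (j : 'I_n.+1) (s : 'S_n) (e : {ffun 'I_n.+1 -> bool}) :
  kz (lift_perm ord0 j s) e = (e j && below e j) (+) kz s (liftf j e).
Proof.
rewrite /kz /koszul big_ord_recl oddD; congr (_ (+) _).
  rewrite odd_sum big_mkcond big_ord_recl /= -(@below_perm_lift _ _ _ s).
  by apply: eq_bigr => l _; rewrite oddb lift_perm_id lift_perm_lift.
congr odd; apply: eq_bigr => i _.
rewrite big_mkcond big_ord_recl /= add0n [RHS]big_mkcond; apply: eq_bigr => l _.
rewrite !lift_perm_lift !ffunE ltnS; congr (if _ then nat_of_bool (_ && _) else _).
by rewrite !ltnNge leq_bump2.
Qed.

Lemma kz_liftmax n (j : 'I_n.+1) (s : 'S_n) (e : {ffun 'I_n.+1 -> bool}) :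
  kz (lift_perm ord_max j s) e
  = (\big[addb/false]_l [&& (j < lift j (s l))%N, e j & e (lift j (s l))])
    (+) kz s (liftf j e).
Proof.
have lw (l : 'I_n) : widen_ord (leqnSn n) l = lift ord_max l.
  by apply: val_inj; rewrite /= /bump leqNgt ltn_ord.
rewrite /kz /koszul big_ord_recr /= [X in (_ + X)%N]big1 ?addn0; last first.
  by move=> l; rewrite ltnNge -ltnS ltn_ord.
rewrite !odd_sum -big_split /=.
apply: eq_bigr => i _; rewrite lw big_mkcond big_ord_recr /= oddD addbC.
rewrite ltn_ord lift_perm_id !lift_perm_lift oddb /=.
congr (_ (+) _); first by rewrite [e j && _]andbC.
congr odd; rewrite [RHS]big_mkcond; apply: eq_bigr => l _.
case: ifP => // _.
by rewrite lw !lift_perm_lift !ffunE !ltnNge leq_bump2.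
Qed.

Lemma below0 n (e : {ffun 'I_n -> bool}) : below e 0 = false.
Proof. exact: big_pred0. Qed.

(** Passing between the degree and the shifted degree flips the parity of each of the [i] letters
    concerned. *)
Lemma below_neg n (e : {ffun 'I_n -> bool}) i :
  (i <= n)%N -> below [ffun j => ~~ e j] i = odd i (+) below e i.
Proof.
move=> le_in; have -> : odd i = \big[addb/false]_(l < n | (l < i)%N) true.
  rewrite -(big_ord_widen n (fun=> true)) // big_const_ord.
  by elim: i {le_in} => //= i ->.
by rewrite -big_split; apply: eq_bigr => l _; rewrite ffunE.
Qed.

(** Supplies the induction step of [kz_skew], and describes the stabilizer of a slot by permutations
    of the remaining ones. *)
Lemma perm_liftP n (i j : 'I_n.+1) (s : 'S_n.+1) :
  s i = j -> exists t : 'S_n, s = lift_perm i j t.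
Proof.
move=> sij.
have tP k : {l | s (lift i k) = lift j l}.
  have : s (lift i k) != j by rewrite -sij (inj_eq perm_inj) eq_sym neq_lift.
  by rewrite eq_sym => /unlift_some[l -> _]; exists l.
have inj : injective (fun k => sval (tP k)).
  move=> k k'; case: (tP k) => l /= El; case: (tP k') => l' /= El' ll.
  by apply: (@lift_inj _ i); apply: (@perm_inj _ s); rewrite El El' ll.
exists (perm inj); apply/permP => k; case: (unliftP i k) => [k' ->|->].
  by rewrite lift_perm_lift permE; case: (tP k').
by rewrite lift_perm_id.
Qed.

(** Removing letter [i] removes its own weight [n - i] and lowers by one the weight of every letter
    before it, whence the term [below]. *)
Lemma wt_lift n (e : {ffun 'I_n.+1 -> bool}) (i : 'I_n.+1) :
  wt e = (odd (n - i) && e i) (+) below e i (+) wt (liftf i e).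
Proof.
rewrite /wt odd_sum (bigD1_ord i) //= subSS oddM oddb -addbA; congr (_ (+) _).
rewrite odd_sum -below_lift /below [X in X (+) _]big_mkcond -big_split.
apply: eq_bigr => l _ /=; rewrite !oddM !oddb ffunE subSS.
rewrite /bump; case: (leqP i l) => il /=; first by [].
rewrite add0n -[in LHS](subnSK (ltn_ord l)) /=; case: (odd _); by case: (e _).
Qed.

(** The sign identity of the shift: with [e] the parities of the shifted degrees, it exchanges
    skewsymmetry for the degree of U and symmetry for that of U[1]. The induction splits off the
    letter that [s] moves to the front. *)
Lemma kz_skew n (s : 'S_n) (e : {ffun 'I_n -> bool}) :
  kz s e (+) wt (permf s e)
  = wt e (+) odd_perm s (+) kz s [ffun i => ~~ e i].
Proof.
elim: n s e => [|n IH] s e.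
  rewrite (_ : s = 1%g) ?odd_perm1 ?kz1 //; last by apply/permP => -[].
  by rewrite /wt !big_ord0.
have [t ->] := perm_liftP (erefl (s ord0)); set i := s ord0.
rewrite !kz_lift0 odd_lift_perm (wt_lift e i) (wt_lift _ ord0) /=.
have -> : liftf ord0 (permf (lift_perm ord0 i t) e) = permf t (liftf i e).
  by apply/ffunP => l; rewrite !ffunE lift_perm_lift.
have -> : liftf i [ffun i => ~~ e i] = [ffun i0 => ~~ liftf i e i0].
  by apply/ffunP => l; rewrite !ffunE.
have := IH t (liftf i e).
have -> : below (permf (lift_perm ord0 i t) e) 0 = false.
  exact: below0.
have -> : below [ffun i => ~~ e i] i = odd i (+) below e i.
  by rewrite below_neg // ltnW.
rewrite !ffunE lift_perm_id subn0 oddB => [H|]; last by rewrite -ltnS.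
rewrite -[wt (permf t _)](addKb (kz t (liftf i e))) H.
move: (kz t _) (kz t _) (wt _) (odd_perm t) (below e i) (e i) (odd i) (odd n).
by do 8!case.
Qed.
End Koszul.

(** * Multilinear forms and symmetrization *)

Section Parity.
Variables (F : fieldType) (U : vectType F) (G : grading U).

Lemma hcompZ i a x : hcomp G i (a *: x) = a *: hcomp G i x.
Proof. by rewrite -[a *: x]addr0 hcomp_linear hcomp0 addr0. Qed.

Lemma par_linear b : linear (par G b).
Proof.
move=> a x y; rewrite /par scaler_sumr -big_split; apply: eq_bigr => i _.
by rewrite hcomp_linear.
Qed.

Lemma dpar_linear b : linear (dpar G b).
Proof. exact: par_linear. Qed.

Lemma hcomp_hom i d x : homog G d x -> hcomp G i x = if i == d then x else 0.
Proof. by move=> hx; rewrite -[in LHS]hx hcompK; case: eqP => // ->. Qed.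

Lemma par_hom b d x : homog G d x -> par G b x = if odd `|d|%N == b then x else 0.
Proof.
move=> hx; rewrite /par (eq_bigr (fun i => if i == d then x else 0)); last first.
  by move=> i _; apply: hcomp_hom.
rewrite -big_mkcondr; case: (boolP (d \in hdegs G)) => [din|dN]; last first.
  rewrite big1_seq; first by rewrite -hx hcomp_out // if_same.
  by move=> i /andP[/andP[_ /eqP ->]]; rewrite (negPf dN).
rewrite -big_filter (_ : filter _ _ = if odd `|d|%N == b then [:: d] else [::]).
  by case: ifP => _; rewrite ?big_nil // big_seq1.
have F1 : filter (pred1 d) (hdegs G) = [:: d].
  by rewrite filter_pred1_uniq // hdegs_uniq.
transitivity (filter (fun i : int => odd `|i|%N == b) (filter (pred1 d) (hdegs G))).
  by rewrite -filter_predI.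
by rewrite F1 /=.
Qed.

Lemma homog_hcomp d x : homog G d (hcomp G d x).
Proof. by rewrite /homog hcompK eqxx. Qed.

Lemma homog0 d : homog G d 0. Proof. exact: hcomp0. Qed.

Lemma homogZ d a x : homog G d x -> homog G d (a *: x).
Proof. by rewrite /homog hcompZ => ->. Qed.

Lemma homog_par d b x : homog G d x -> homog G d (par G b x).
Proof. by move=> hx; rewrite (par_hom _ hx); case: ifP => // _; apply: homog0. Qed.

Lemma linear_homog (T : lmodType F) (f g : U -> T) :
  linear f -> linear g -> (forall d x, homog G d x -> f x = g x) -> f =1 g.
Proof.
move=> lf lg fg x.
pose f' : {linear U -> T} := HB.pack f (GRing.isLinear.Build F U T *:%R f lf).
pose g' : {linear U -> T} := HB.pack g (GRing.isLinear.Build F U T *:%R g lg).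
rewrite -(hcomp_sum G x) -[f _]/(f' _) -[g _]/(g' _) !linear_sum.
by apply: eq_bigr => i _; apply: fg (homog_hcomp i x).
Qed.

Lemma par_sum x : par G false x + par G true x = x.
Proof.
have l : linear (fun x => par G false x + par G true x).
  by move=> a y z; rewrite !par_linear scalerDr addrACA.
apply: (linear_homog l) => // d y hy; rewrite !(par_hom _ hy).
by case: odd; rewrite ?add0r ?addr0.
Qed.
End Parity.

Section LinearTools.
Variables (F : fieldType) (U T : lmodType F).
Implicit Types f : U -> T.

Lemma lin0 f : linear f -> f 0 = 0.
Proof. by move=> lf; have := lf (-1) 0 0; rewrite !scaleN1r oppr0 addr0 addNr. Qed.

Lemma linD f x y : linear f -> f (x + y) = f x + f y.
Proof. by move=> lf; rewrite -[x in LHS]scale1r lf scale1r. Qed.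

Lemma linZ f a x : linear f -> f (a *: x) = a *: f x.
Proof. by move=> lf; rewrite -[a *: x]addr0 lf (lin0 lf) addr0. Qed.

Lemma linN f x : linear f -> f (- x) = - f x.
Proof. by move=> lf; rewrite -scaleN1r linZ // scaleN1r. Qed.

Lemma lin_sum f (I : Type) (r : seq I) (P : pred I) (g : I -> U) :
  linear f -> f (\sum_(i <- r | P i) g i) = \sum_(i <- r | P i) f (g i).
Proof.
by move=> lf; apply: (big_morph f) => [x y|]; [exact: linD | exact: lin0].
Qed.
End LinearTools.

Lemma linfunE' (F : fieldType) (U V : vectType F) (f : U -> V) :
  linear f -> linfun f =1 f.
Proof.
move=> lf x.
pose f' : {linear U -> V} := HB.pack f (GRing.isLinear.Build F U V *:%R f lf).
by rewrite -[f]/(f' : U -> V) lfunE.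
Qed.

Section Multi.
Variables (F : fieldType) (U : vectType F) (G : grading U).

Lemma upd_same n (u : {ffun 'I_n -> U}) i : upd u i (u i) = u.
Proof. by apply/ffunP => j; rewrite ffunE; case: eqP => // ->. Qed.

Lemma upd_permf n (u : {ffun 'I_n -> U}) i x (s : 'S_n) :
  permf s (upd u i x) = upd (permf s u) ((s^-1)%g i) x.
Proof.
apply/ffunP => j; rewrite !ffunE -[j == _](inj_eq (@perm_inj _ s)) permKV.
by case: eqP.
Qed.

Lemma permfM (A : Type) n (u : {ffun 'I_n -> A}) (s t : 'S_n) :
  permf t (permf s u) = permf (t * s)%g u.
Proof. by apply/ffunP => j; rewrite !ffunE permM. Qed.

Section Forms.
Variable T : lmodType F.

Lemma multi0 n (f : {ffun 'I_n -> U} -> T) (u : {ffun 'I_n -> U}) (i : 'I_n) :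
  multilinear f -> u i = 0 -> f u = 0.
Proof.
move=> mf ui; have := mf u i (-1) 0 0.
by rewrite !scaleN1r oppr0 addr0 addNr -ui upd_same.
Qed.

Lemma multi_linear n (f : {ffun 'I_n -> U} -> T) u i :
  multilinear f -> linear (fun x => f (upd u i x)).
Proof. by move=> mf a x y; apply: mf. Qed.

(** The slots are split into homogeneous components one after the other, by induction on the number
    [m] of leading slots not known to be homogeneous. *)
Lemma multi_ext n (f g : {ffun 'I_n -> U} -> T) :
  multilinear f -> multilinear g ->
  (forall (d : {ffun 'I_n -> int}) (u : {ffun 'I_n -> U}), (forall i, homog G (d i) (u i)) -> f u = g u) ->
  f =1 g.
Proof.
move=> mf mg fg u.
suff H m : (m <= n)%N -> forall (d : {ffun 'I_n -> int}) (u : {ffun 'I_n -> U}),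
    (forall i : 'I_n, (m <= i)%N -> homog G (d i) (u i)) -> f u = g u.
  (* For [m = n] no slot is required to be homogeneous, so the degrees given here are dummies. *)
  by apply: (H n (leqnn n) [ffun=> 0]) => i; rewrite leqNgt ltn_ord.
elim: m => [_ d v hv|m IH mn d v hv]; first by apply: (fg d) => i; apply: hv.
pose i0 := Ordinal mn; rewrite -(upd_same v i0).
apply: (linear_homog (G := G) (multi_linear v i0 mf) (multi_linear v i0 mg)) => e x hx.
apply: (IH (ltnW mn) [ffun i => if i == i0 then e else d i]) => i mi.
rewrite !ffunE; case: (eqVneq i i0) => // ne; apply: hv.
by rewrite ltn_neqAle mi andbT eq_sym -(inj_eq val_inj) in ne *.
Qed.

Lemma multiD n (f g : {ffun 'I_n -> U} -> T) :
  multilinear f -> multilinear g -> multilinear (fun u => f u + g u).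
Proof. by move=> mf mg u i a x y; rewrite mf mg scalerDr addrACA. Qed.

Lemma multiZ n (f : {ffun 'I_n -> U} -> T) b :
  multilinear f -> multilinear (fun u => b *: f u).
Proof. by move=> mf u i a x y; rewrite mf scalerDr !scalerA mulrC. Qed.

Lemma multi_sum n (I : Type) (r : seq I) (P : pred I)
  (f : I -> {ffun 'I_n -> U} -> T) :
  (forall i, P i -> multilinear (f i)) ->
  multilinear (fun u => \sum_(i <- r | P i) f i u).
Proof.
move=> mf u i a x y; rewrite scaler_sumr -big_split.
by apply: eq_bigr => j Pj; rewrite mf.
Qed.

Lemma multi_permf n (f : {ffun 'I_n -> U} -> T) (s : 'S_n) :
  multilinear f -> multilinear (fun u => f (permf s u)).
Proof. by move=> mf u i a x y; rewrite !upd_permf mf. Qed.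

Lemma multi_map n (f : {ffun 'I_n -> U} -> T) (P : 'I_n -> U -> U) :
  multilinear f -> (forall i, linear (P i)) ->
  multilinear (fun u => f [ffun i => P i (u i)]).
Proof.
move=> mf lP u i a x y.
have E z : [ffun j => P j (upd u i z j)] = upd [ffun j => P j (u j)] i (P i z).
  by apply/ffunP => j; rewrite !ffunE; case: eqP => // ->.
by rewrite !E lP mf.
Qed.

(** * The signed action of permutations, for either parity of the letters *)

Section Pact.
Variables (P : bool -> U -> U) (pr : int -> bool).
Hypothesis lP : forall b, linear (P b).
Hypothesis Ppr : forall b d x, homog G d x -> P b x = if pr d == b then x else 0.

Lemma pactP n (s : 'S_n) (f : {ffun 'I_n -> U} -> T) u :
  pact P s f u = \sum_e (-1) ^+ kz s e *: f (permf s [ffun i => P (e i) (u i)]).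
Proof.
apply: eq_bigr => e _; rewrite signr_odd; congr (_ *: f _).
by apply/ffunP => i; rewrite !ffunE.
Qed.

Lemma pact_multi n (s : 'S_n) (f : {ffun 'I_n -> U} -> T) :
  multilinear f -> multilinear (pact P s f).
Proof.
move=> mf u i a x y; rewrite !pactP scaler_sumr -big_split; apply: eq_bigr => e _.
exact: (multiZ ((-1) ^+ kz s e) (multi_map (multi_permf s mf) (fun i => lP (e i)))).
Qed.

Lemma eq_pact n (s : 'S_n) (f g : {ffun 'I_n -> U} -> T) :
  f =1 g -> pact P s f =1 pact P s g.
Proof. by move=> fg u; apply: eq_bigr => e _; rewrite fg. Qed.

Lemma pactD n (s : 'S_n) (f g : {ffun 'I_n -> U} -> T) u :
  pact P s (fun u => f u + g u) u = pact P s f u + pact P s g u.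
Proof. by rewrite -big_split; apply: eq_bigr => e _; rewrite scalerDr. Qed.

Lemma pactZ n (s : 'S_n) (f : {ffun 'I_n -> U} -> T) a u :
  pact P s (fun u => a *: f u) u = a *: pact P s f u.
Proof.
by rewrite scaler_sumr; apply: eq_bigr => e _; rewrite !scalerA mulrC.
Qed.

Lemma pact_sum n (s : 'S_n) (I : finType) (Q : pred I)
  (f : I -> {ffun 'I_n -> U} -> T) u :
  pact P s (fun u => \sum_(i | Q i) f i u) u = \sum_(i | Q i) pact P s (f i) u.
Proof.
by rewrite exchange_big; apply: eq_bigr => e _; rewrite scaler_sumr.
Qed.

Definition hpr n (d : {ffun 'I_n -> int}) : {ffun 'I_n -> bool} :=
  [ffun i => pr (d i)].

(** Any pattern other than the parities of the degrees annihilates the letter of some slot, and with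
    it the multilinear value. *)
Lemma big_hpr n (d : {ffun 'I_n -> int}) (u : {ffun 'I_n -> U}) (w : {ffun 'I_n -> bool} -> F)
    (f : {ffun 'I_n -> U} -> T) :
  multilinear f -> (forall i, homog G (d i) (u i)) ->
  \sum_e w e *: f [ffun i => P (e i) (u i)] = w (hpr d) *: f u.
Proof.
move=> mf hu; rewrite (bigD1 (hpr d)) //= [X in _ + X]big1 ?addr0 => [|e ne].
  by congr (_ *: f _); apply/ffunP => i; rewrite !ffunE (Ppr _ (hu i)) eqxx.
have [i ni] : exists i, e i != hpr d i.
  by apply/existsP; apply: contraNT ne => /existsPn H; apply/eqP/ffunP => i;
     apply/eqP; have := H i; rewrite negbK.
rewrite (multi0 (i := i) mf) ?scaler0 // ffunE (Ppr _ (hu i)).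
by rewrite ffunE in ni; rewrite eq_sym (negPf ni).
Qed.

Lemma pactE n (s : 'S_n) (f : {ffun 'I_n -> U} -> T) (d : {ffun 'I_n -> int}) (u : {ffun 'I_n -> U}) :
  multilinear f -> (forall i, homog G (d i) (u i)) ->
  pact P s f u = (-1) ^+ kz s (hpr d) *: f (permf s u).
Proof.
move=> mf hu; rewrite pactP.
exact: (big_hpr (fun e => (-1) ^+ kz s e) (multi_permf s mf) hu).
Qed.

Lemma hpr_permf n (d : {ffun 'I_n -> int}) (s : 'S_n) :
  hpr (permf s d) = permf s (hpr d).
Proof. by apply/ffunP => i; rewrite !ffunE. Qed.

Lemma pactM n (s t : 'S_n) (f : {ffun 'I_n -> U} -> T) :
  multilinear f -> pact P t (pact P s f) =1 pact P (s * t)%g f.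
Proof.
move=> mf; have ms := pact_multi s mf.
apply: multi_ext => [||d u hu]; try exact: pact_multi.
rewrite (pactE _ ms hu) (pactE (d := permf t d) s mf); last first.
  by move=> i; rewrite !ffunE.
by rewrite (pactE _ mf hu) kzM permfM signr_addb scalerA hpr_permf; congr (_ *: _); apply: mulrC.
Qed.

Lemma pact1 n (f : {ffun 'I_n -> U} -> T) : multilinear f -> pact P 1 f =1 f.
Proof.
move=> mf; apply: multi_ext => [||d u hu] //; first exact: pact_multi.
rewrite (pactE _ mf hu) kz1 scale1r; congr f.
by apply/ffunP => i; rewrite !ffunE perm1.
Qed.

(** Invariance is asked only on [S], so that the stabilizers of distinguished slots can be used as
    well as the whole group. *)
Definition sym_on n (S : 'S_n -> Prop) (f : {ffun 'I_n -> U} -> T) : Prop :=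
  forall s, S s -> pact P s f =1 f.

(** [s] and [s'] differ by an element of the stabilizer of [z]. Only the letter that lands in slot
    [z] therefore matters, and representatives may be exchanged freely. *)
Lemma pact_coset n (z : 'I_n) (f : {ffun 'I_n -> U} -> T) (s s' : 'S_n) :
  multilinear f -> sym_on (fun s => s z = z) f -> s z = s' z ->
  pact P s f =1 pact P s' f.
Proof.
move=> mf fz E u; have /(fz _) H : (s * s'^-1)%g z = z by rewrite !permM E permK.
by rewrite -[RHS](eq_pact _ H) pactM // mulgKV.
Qed.

(** The sum runs over representatives of the cosets of the stabilizer of [z], and a permutation only
    permutes these cosets. *)
Lemma orbit_sum_sym n (z : 'I_n) (t : 'I_n -> 'S_n) (f : {ffun 'I_n -> U} -> T) :
  multilinear f -> (forall i, t i z = i) -> sym_on (fun s => s z = z) f ->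
  sym_on (fun=> True) (fun u => \sum_i pact P (t i) f u).
Proof.
move=> mf tz fz s _ u; rewrite pact_sum [RHS](reindex_inj (@perm_inj _ s)) /=.
apply: eq_bigr => i _; rewrite pactM //.
by apply: (pact_coset mf fz); rewrite permM !tz.
Qed.

(** The same argument for unordered pairs: invariance under [w], which exchanges the two
    distinguished slots, lets the sum be restricted to increasing pairs. *)
Lemma orbit_pair_sum_sym n (z z' : 'I_n) (t : 'I_n -> 'I_n -> 'S_n) (w : 'S_n)
    (f : {ffun 'I_n -> U} -> T) :
  multilinear f ->
  (forall i j, i != j -> t i j z = i /\ t i j z' = j) ->
  w z = z' -> w z' = z ->
  sym_on (fun s => (s z = z /\ s z' = z') \/ s = w) f ->
  sym_on (fun=> True)
    (fun u => \sum_(p : 'I_n * 'I_n | (p.1 < p.2)%N) pact P (t p.1 p.2) f u).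
Proof.
move=> mf tE wz wz' fz.
have tt (s s' : 'S_n) : s z = s' z -> s z' = s' z' -> pact P s f =1 pact P s' f.
  move=> E E' u; have /(fz _) H : ((s * s'^-1)%g z = z /\ (s * s'^-1)%g z' = z')
      \/ (s * s'^-1)%g = w by left; rewrite !permM E E' !permK.
  by rewrite -[RHS](eq_pact _ H) pactM // mulgKV.
move=> s _ u; rewrite pact_sum.
rewrite -(@big_sym_pairs _ _ _ _ s (fun i j => pact P (t i j) f u)); last first.
  move=> i j ij; have [Ei Ej] := tE _ _ ij.
  rewrite eq_sym in ij; have [Ei' Ej'] := tE _ _ ij.
  have /(fz _) H : (w z = z /\ w z' = z') \/ w = w by right.
  by rewrite -[LHS](eq_pact _ H) pactM //; apply: tt; rewrite !permM ?wz ?wz' ?Ei ?Ej ?Ei' ?Ej'.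
apply: eq_bigr => -[i j] /= ij; rewrite pactM //.
have nij : i != j by apply: contraTneq ij => ->; rewrite ltnn.
have [Ei Ej] := tE _ _ nij.
have [Ei' Ej'] : t (s i) (s j) z = s i /\ t (s i) (s j) z' = s j.
  by apply: tE; rewrite (inj_eq perm_inj).
by apply: tt; rewrite !permM ?Ei ?Ej ?Ei' ?Ej'.
Qed.

(** Convertible to [Sym] for forms with the shifted parity. *)
Definition symz n (f : {ffun 'I_n -> U} -> T) u : T := \sum_(s : 'S_n) pact P s f u.

Lemma symz_pact n (f : {ffun 'I_n -> U} -> T) t :
  multilinear f -> symz (pact P t f) =1 symz f.
Proof.
move=> mf u; rewrite /symz [RHS](reindex_inj (mulgI t)) /=.
by apply: eq_bigr => s _; rewrite pactM.
Qed.

Lemma symz_sym n (f : {ffun 'I_n -> U} -> T) u :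
  sym_on (fun=> True) f -> symz f u = (n`!)%:R *: f u.
Proof.
move=> fs; rewrite /symz (eq_bigr (fun=> f u)) => [|s _]; last exact: fs.
by rewrite sumr_const scaler_nat card_Sn.
Qed.

Lemma eq_symz n (f g : {ffun 'I_n -> U} -> T) : f =1 g -> symz f =1 symz g.
Proof. by move=> fg u; apply: eq_bigr => s _; apply: eq_pact. Qed.

Lemma symzD n (f g : {ffun 'I_n -> U} -> T) u :
  symz (fun u => f u + g u) u = symz f u + symz g u.
Proof. by rewrite -big_split; apply: eq_bigr => s _; rewrite pactD. Qed.

Lemma symzZ n (f : {ffun 'I_n -> U} -> T) a u :
  symz (fun u => a *: f u) u = a *: symz f u.
Proof. by rewrite scaler_sumr; apply: eq_bigr => s _; rewrite pactZ. Qed.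

Lemma symz_sum n (I : finType) (Q : pred I) (f : I -> {ffun 'I_n -> U} -> T) u :
  symz (fun u => \sum_(i | Q i) f i u) u = \sum_(i | Q i) symz (f i) u.
Proof. by rewrite exchange_big; apply: eq_bigr => s _; rewrite pact_sum. Qed.
End Pact.

End Forms.
End Multi.

(** * Words with distinguished first or last letters *)

Section Slots.
Variables (A : Type).

Lemma liftf_permf n (i j : 'I_n.+1) (s : 'S_n) (u : {ffun 'I_n.+1 -> A}) :
  liftf i (permf (lift_perm i j s) u) = permf s (liftf j u).
Proof. by apply/ffunP => l; rewrite !ffunE lift_perm_lift. Qed.

Lemma permf1 n (u : {ffun 'I_n -> A}) : permf 1 u = u.
Proof. by apply/ffunP => i; rewrite !ffunE perm1. Qed.
End Slots.

Section Tuples.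
Variables (F : fieldType) (U : vectType F).

Lemma liftf_upd_same n (u : {ffun 'I_n.+1 -> U}) i x :
  liftf i (upd u i x) = liftf i u.
Proof. by apply/ffunP => l; rewrite !ffunE eq_sym (negPf (neq_lift _ _)). Qed.

Lemma liftf_upd_lift n (u : {ffun 'I_n.+1 -> U}) i j x :
  liftf i (upd u (lift i j) x) = upd (liftf i u) j x.
Proof. by apply/ffunP => l; rewrite !ffunE (inj_eq lift_inj). Qed.

Lemma consf0 n (u : {ffun 'I_n -> U}) x : consf x u ord0 = x.
Proof. by rewrite ffunE unlift_none. Qed.

Lemma consf_lift n (u : {ffun 'I_n -> U}) x i : consf x u (lift ord0 i) = u i.
Proof. by rewrite ffunE liftK. Qed.

Lemma upd_consf0 n (u : {ffun 'I_n -> U}) x y : upd (consf x u) ord0 y = consf y u.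
Proof.
by apply/ffunP => l; rewrite !ffunE; case: unliftP => [j ->|->].
Qed.

Lemma upd_consf n (u : {ffun 'I_n -> U}) x y i :
  upd (consf x u) (lift ord0 i) y = consf x (upd u i y).
Proof.
apply/ffunP => l; rewrite !ffunE; case: unliftP => [j ->|->] //=.
by rewrite ffunE (inj_eq lift_inj).
Qed.

Lemma snocf_max n (u : {ffun 'I_n -> U}) x : snocf u x ord_max = x.
Proof. by rewrite ffunE unlift_none. Qed.

Lemma snocf_lift n (u : {ffun 'I_n -> U}) x i : snocf u x (lift ord_max i) = u i.
Proof. by rewrite ffunE liftK. Qed.

Lemma initf_snocf n (u : {ffun 'I_n -> U}) x : initf (snocf u x) = u.
Proof. by apply/ffunP => l; rewrite ffunE snocf_lift. Qed.

Lemma snocf_eta n (u : {ffun 'I_n.+1 -> U}) : snocf (initf u) (u ord_max) = u.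
Proof.
by apply/ffunP => l; rewrite ffunE; case: unliftP => [j ->|->] //=; rewrite ffunE.
Qed.

Lemma upd_snocf_max n (u : {ffun 'I_n -> U}) x y :
  upd (snocf u x) ord_max y = snocf u y.
Proof.
apply/ffunP => l; rewrite !ffunE; case: unliftP => [j ->|->]; last by rewrite eqxx.
by rewrite eq_sym (negPf (neq_lift _ _)).
Qed.

Lemma upd_snocf n (u : {ffun 'I_n -> U}) x y i :
  upd (snocf u x) (lift ord_max i) y = snocf (upd u i y) x.
Proof.
apply/ffunP => l; rewrite !ffunE; case: unliftP => [j ->|->].
  by rewrite /= ffunE (inj_eq lift_inj).
by rewrite (negPf (neq_lift _ _)).
Qed.

Definition cons2f (R : U -> U -> U) n (u : {ffun 'I_n.+2 -> U}) : {ffun 'I_n.+1 -> U} :=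
  consf (R (u ord0) (u (lift ord0 ord0))) (liftf ord0 (liftf ord0 u)).

Section MultiSlots.
Variables (X T : lmodType F).

Lemma multi_slot (B : U -> X -> T) n (i : 'I_n.+1) (f : {ffun 'I_n -> U} -> X) :
  bilin B -> multilinear f -> multilinear (fun u => B (u i) (f (liftf i u))).
Proof.
move=> [B1 B2] mf u j a x y; case: (unliftP i j) => [l ->|->].
  by rewrite !liftf_upd_lift mf !ffunE (negPf (neq_lift _ _)) B1.
by rewrite !liftf_upd_same !ffunE eqxx B2.
Qed.

Lemma multi_consf n (f : {ffun 'I_n.+1 -> U} -> T) x :
  multilinear f -> multilinear (fun u => f (consf x u)).
Proof. by move=> mf u i a y z; rewrite -!upd_consf mf. Qed.

Lemma linear_consf n (f : {ffun 'I_n.+1 -> U} -> T) u :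
  multilinear f -> linear (fun x => f (consf x u)).
Proof. by move=> mf a y z; have := mf (consf 0 u) ord0 a y z; rewrite !upd_consf0. Qed.

Lemma multi_snocf n (f : {ffun 'I_n.+1 -> U} -> T) x :
  multilinear f -> multilinear (fun u => f (snocf u x)).
Proof. by move=> mf u i a y z; rewrite -!upd_snocf mf. Qed.

Lemma linear_snocf n (f : {ffun 'I_n.+1 -> U} -> T) u :
  multilinear f -> linear (fun x => f (snocf u x)).
Proof. by move=> mf a y z; have := mf (snocf u 0) ord_max a y z; rewrite !upd_snocf_max. Qed.

Lemma multi_cons2f (R : U -> U -> U) n (f : {ffun 'I_n.+1 -> U} -> T) :
  bilin R -> multilinear f -> multilinear (fun u => f (cons2f R u)).
Proof.
move=> [R1 R2] mf u i a x y; rewrite /cons2f.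
have l0 m (j : 'I_m) : (lift ord0 j == ord0) = false by [].
case: (unliftP ord0 i) => [j ->|->]; last first.
  by rewrite !liftf_upd_same !ffunE eqxx l0 R2 (linear_consf _ mf).
rewrite !liftf_upd_lift !ffunE; case: (unliftP ord0 j) => [l ->|->]; last first.
  by rewrite !liftf_upd_same eqxx R1 (linear_consf _ mf).
by rewrite !liftf_upd_lift !(inj_eq lift_inj) /= (multi_consf _ mf).
Qed.
End MultiSlots.

Lemma multi_comp (U' : vectType F) (T : lmodType F) (L : U -> U') n
    (f : {ffun 'I_n -> U'} -> T) :
  linear L -> multilinear f -> multilinear (fun u => f [ffun i => L (u i)]).
Proof.
move=> lL mf u i a x y.
have E z : [ffun j => L (upd u i z j)] = upd [ffun j => L (u j)] i (L z).
  by apply/ffunP => j; rewrite !ffunE; case: eqP.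
by rewrite !E lL mf.
Qed.

Lemma pact_comp (U' : vectType F) (T : lmodType F) (L : U -> U')
    (P : bool -> U -> U) (P' : bool -> U' -> U') n (s : 'S_n)
    (f : {ffun 'I_n -> U'} -> T) u :
  (forall b x, L (P b x) = P' b (L x)) ->
  pact P s (fun v => f [ffun i => L (v i)]) u = pact P' s f [ffun i => L (u i)].
Proof.
move=> LP; apply: eq_bigr => e _; congr (_ *: f _).
by apply/ffunP => i; rewrite !ffunE LP.
Qed.

Lemma pact_post (X T : lmodType F) (L : X -> T) (P : bool -> U -> U) n (s : 'S_n)
    (f : {ffun 'I_n -> U} -> X) u :
  linear L -> pact P s (fun v => L (f v)) u = L (pact P s f u).
Proof.
by move=> lL; rewrite lin_sum //; apply: eq_bigr => e _; rewrite linZ.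
Qed.
End Tuples.

Lemma kz_lift00 n (s : 'S_n) (e : {ffun 'I_n.+1 -> bool}) :
  kz (lift_perm ord0 ord0 s) e = kz s (liftf ord0 e).
Proof. by rewrite kz_lift0 below0 andbF. Qed.

Lemma kz_liftmm n (s : 'S_n) (e : {ffun 'I_n.+1 -> bool}) :
  kz (lift_perm ord_max ord_max s) e = kz s (liftf ord_max e).
Proof.
rewrite kz_liftmax big1 // => l _.
by rewrite ltnNge -ltnS ltn_ord.
Qed.

(* lift_perm ord_max ord0 1 moves the first letter to the end. *)
Lemma kz_liftm0 n (e : {ffun 'I_n.+1 -> bool}) :
  kz (lift_perm ord_max ord0 1) e = e ord0 && btot (liftf ord0 e).
Proof.
rewrite kz_liftmax kz1 addbF /btot mulb_addl.
by apply: eq_bigr => l _; rewrite ffunE perm1.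
Qed.

Section PactSlots.
Variables (F : fieldType) (U : vectType F) (G : grading U).
Variables (P : bool -> U -> U) (pr : int -> bool).
Hypothesis lP : forall b, linear (P b).
Hypothesis Ppr : forall b d x, homog G d x -> P b x = if pr d == b then x else 0.

Lemma homog_liftf n (i : 'I_n.+1) (d : {ffun 'I_n.+1 -> int})
    (u : {ffun 'I_n.+1 -> U}) :
  (forall i, homog G (d i) (u i)) -> forall j, homog G (liftf i d j) (liftf i u j).
Proof. by move=> hu j; rewrite !ffunE. Qed.

Lemma hpr_liftf n (i : 'I_n.+1) (d : {ffun 'I_n.+1 -> int}) :
  hpr pr (liftf i d) = liftf i (hpr pr d).
Proof. by apply/ffunP => j; rewrite !ffunE. Qed.

(** The hypothesis on [kz] covers both ends of a word: a letter that stays first or last is crossed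
    by nothing ([kz_lift00], [kz_liftmm]). *)
Lemma pact_slot (X T : lmodType F) (B : U -> X -> T) n (i : 'I_n.+1) (s : 'S_n)
    (f : {ffun 'I_n -> U} -> X) :
  (forall e, kz (lift_perm i i s) e = kz s (liftf i e)) ->
  bilin B -> multilinear f ->
  pact P (lift_perm i i s) (fun u => B (u i) (f (liftf i u)))
  =1 (fun u => B (u i) (pact P s f (liftf i u))).
Proof.
move=> Ek bB mf; have mB := multi_slot i bB mf.
apply: (multi_ext (G := G)) => [||d u hu]; first exact: (pact_multi lP).
  exact: (multi_slot i bB (pact_multi lP s mf)).
rewrite (pactE Ppr _ mB hu) (pactE Ppr _ mf (homog_liftf i hu)) Ek hpr_liftf.
by rewrite liftf_permf linZ ?ffunE ?lift_perm_id //; case: bB.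
Qed.

(** The first letter crosses nothing, so [w] need not be homogeneous. In [pact_cons2f] it is the
    value of [R], about whose degree nothing is assumed. *)
Lemma pact_consf (T : lmodType F) n (s : 'S_n) (f : {ffun 'I_n.+1 -> U} -> T)
    (d : {ffun 'I_n -> int}) (v : {ffun 'I_n -> U}) w :
  multilinear f -> (forall i, homog G (d i) (v i)) ->
  pact P (lift_perm ord0 ord0 s) f (consf w v)
  = (-1) ^+ kz s (hpr pr d) *: f (consf w (permf s v)).
Proof.
move=> mf hv; have mp := pact_multi lP (lift_perm ord0 ord0 s) mf.
have l2 : linear (fun w => (-1) ^+ kz s (hpr pr d) *: f (consf w (permf s v))).
  by move=> a x y; rewrite (linear_consf _ mf) scalerDr !scalerA mulrC.
apply: (linear_homog (G := G) (linear_consf v mp) l2) => e {}w hw.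
pose d' : {ffun 'I_n.+1 -> int} := [ffun i => oapp d e (unlift ord0 i)].
have hd : forall i, homog G (d' i) (consf w v i).
  by move=> i; rewrite !ffunE; case: unliftP => [j _|_] /=; [apply: hv | apply: hw].
rewrite (pactE Ppr _ mf hd) kz_lift00 -hpr_liftf.
rewrite (_ : liftf ord0 d' = d); last by apply/ffunP => i; rewrite !ffunE liftK.
congr (_ *: f _); apply/ffunP => i; rewrite !ffunE.
case: (unliftP ord0 i) => [j ->|->]; rewrite ?lift_perm_id ?lift_perm_lift.
  by rewrite !liftK /= ffunE.
by rewrite !unlift_none.
Qed.

Lemma pact_cons2f (T : lmodType F) (R : U -> U -> U) n (s : 'S_n)
    (f : {ffun 'I_n.+1 -> U} -> T) :
  bilin R -> multilinear f ->
  pact P (lift_perm ord0 ord0 (lift_perm ord0 ord0 s)) (fun u => f (cons2f R u))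
  =1 fun u => pact P (lift_perm ord0 ord0 s) f (cons2f R u).
Proof.
move=> bR mf; have mR := multi_cons2f bR mf.
apply: (multi_ext (G := G)) => [||d u hu]; first exact: (pact_multi lP).
  exact: (multi_cons2f bR (pact_multi lP _ mf)).
rewrite (pactE Ppr _ mR hu) !kz_lift00.
rewrite (pact_consf _ _ mf (homog_liftf ord0 (homog_liftf ord0 hu))) !hpr_liftf.
by rewrite /cons2f !liftf_permf !ffunE lift_perm_id lift_perm_lift lift_perm_id.
Qed.
End PactSlots.

(** * The Chevalley coboundary on shifted cochains *)

(** Comparing the signs (-1)^x avoids a discussion of the signs of [a] and [b]. *)
Lemma odd_absD (a b : int) : odd `|(a + b)%R|%N = odd `|a|%N (+) odd `|b|%N.
Proof.
apply: (@Num.Theory.signr_inj int); rewrite signr_addb !signr_odd.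
have E (x : int) : (-1) ^+ `|x|%N = (-1) ^ x :> int by rewrite expN1r.
by rewrite !E exprzDr.
Qed.

Lemma odd_abs_sum (I : finType) (f : I -> int) :
  odd `|(\sum_i f i)%R|%N = \big[addb/false]_i odd `|f i|%N.
Proof. exact: (big_morph (fun x : int => odd `|x|%N) odd_absD). Qed.

Definition dpr (d : int) : bool := ~~ odd `|d|%N.

Lemma dparE (F : fieldType) (U : vectType F) (G : grading U) b d x :
  homog G d x -> dpar G b x = if dpr d == b then x else 0.
Proof.
by move=> hx; rewrite /dpar (par_hom _ hx) /dpr; case: b; case: odd.
Qed.

Lemma hpr_odd n (d : {ffun 'I_n -> int}) :
  hpr (fun d : int => odd `|d|%N) d = [ffun i => ~~ hpr dpr d i].
Proof. by apply/ffunP => i; rewrite !ffunE negbK. Qed.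

Section Shift.
Variables (F : fieldType) (U : vectType F) (G : grading U) (T : lmodType F).

Lemma shiftP n (f : {ffun 'I_n -> U} -> T) u :
  shift G f u = \sum_e (-1) ^+ wt e *: f [ffun j => dpar G (e j) (u j)].
Proof. by apply: eq_bigr => e _; rewrite signr_odd. Qed.

Lemma shift_multi n (f : {ffun 'I_n -> U} -> T) :
  multilinear f -> multilinear (shift G f).
Proof.
move=> mf; apply: multi_sum => e _; apply: multiZ.
exact: (multi_map mf (fun i => dpar_linear G (e i))).
Qed.

Lemma shiftE n (f : {ffun 'I_n -> U} -> T) (d : {ffun 'I_n -> int})
    (u : {ffun 'I_n -> U}) :
  multilinear f -> (forall i, homog G (d i) (u i)) ->
  shift G f u = (-1) ^+ wt (hpr dpr d) *: f u.
Proof.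
move=> mf hu; rewrite shiftP.
exact: (big_hpr (@dparE _ _ G) (fun e => (-1) ^+ wt e) mf hu).
Qed.

Lemma shift_sym n (f : {ffun 'I_n -> U} -> T) :
  multilinear f -> skewsymmetric G f -> sym_on (dpar G) (fun=> True) (shift G f).
Proof.
move=> mf sf s _; have ms := shift_multi mf.
apply: (multi_ext (G := G)) => [||d u hu] //.
  exact: (pact_multi (dpar_linear G)).
rewrite (pactE (@dparE _ _ G) _ ms hu) (shiftE mf hu).
rewrite (shiftE (d := permf s d) mf); last by move=> i; rewrite !ffunE.
rewrite -[in RHS](sf s) (pactE (P := par G) (pr := fun d => odd `|d|%N) _ _ mf hu).
  by rewrite !scalerA -!signr_addb hpr_permf hpr_odd kz_skew.
by move=> b e x hx; apply: par_hom.
Qed.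
End Shift.

(** Both lists are strictly increasing and have the same elements. *)
Lemma enum_lift n (i : 'I_n.+1) :
  [seq l <- enum 'I_n.+1 | l != i] = [seq lift i l | l <- enum 'I_n].
Proof.
apply: (inj_map val_inj); apply: (irr_sorted_eq ltn_trans ltnn).
- have := sorted_filter ltn_trans (fun l : nat => l != i) (iota_ltn_sorted 0 n.+1).
  by rewrite -val_enum_ord filter_map.
- rewrite -map_comp (eq_map (g := bump i \o val)) // map_comp val_enum_ord.
  apply: homo_sorted (iota_ltn_sorted 0 n) => a b ab.
  by rewrite ltnNge leq_bump2 -ltnNge.
move=> x; apply/mapP/mapP => -[l].
  rewrite mem_filter eq_sym => /andP[/unlift_some[l' -> _] _] ->.
  by exists (lift i l') => //; rewrite map_f // mem_enum.
move=> /mapP[l' _ ->] ->; exists (lift i l') => //.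
by rewrite mem_filter mem_enum eq_sym neq_lift.
Qed.

(* Moves the letters i and j to the first two places and keeps the order of the
   others; the identity when i = j. *)
Definition tpair n (i j : 'I_n.+2) : 'S_n.+2 :=
  odflt 1%g (omap (fun j' => lift_perm ord0 i (lift_perm ord0 j' 1)) (unlift i j)).

Lemma tpair_lift n (i : 'I_n.+2) j :
  tpair i (lift i j) = lift_perm ord0 i (lift_perm ord0 j 1).
Proof. by rewrite /tpair liftK. Qed.

Lemma tpairE n (i j : 'I_n.+2) :
  i != j -> tpair i j ord0 = i /\ tpair i j (lift ord0 ord0) = j.
Proof.
move=> /unlift_some[j' -> _].
by rewrite tpair_lift lift_perm_id lift_perm_lift lift_perm_id.
Qed.

Section ShiftedOperations.
Variables (F : fieldType) (V M : vectType F) (GV : grading V).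
Variables (q : V -> V -> V) (act : V -> M -> M).

(** The exponent is |x| p + k deg(x): the first part is the sign of moving x across the letter c in
    [dCh], with |x| = deg(x) + 1 modulo 2, and k is the weight of x as the first of k + 1 letters
    under [shift]. *)
Definition actC (p : int) (k : nat) (x : V) (m : M) : M :=
  \sum_(b : bool) (-1) ^+ (odd `|p|%N (+) (b && (odd `|p|%N (+) odd k)))
    *: act (dpar GV b x) m.

Definition shq (x y : V) : V := \sum_(b : bool) (-1) ^+ b *: q (dpar GV b x) y.

End ShiftedOperations.

Lemma odd_sumb (I : finType) (P : pred I) (f : I -> bool) :
  odd (\sum_(i | P i) f i)%N = \big[addb/false]_(i | P i) f i.
Proof. by rewrite odd_sum; apply: eq_bigr => i _; rewrite oddb. Qed.

Section Cochains.
Variables (F : fieldType) (V M : vectType F) (GV : grading V) (GM : grading M).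
Variables (q : V -> V -> V) (act : V -> M -> M).
Hypothesis lie_q : graded_lie GV q.
Hypothesis mod_act : graded_module GV GM q act.

Lemma dpar_collapse (U : vectType F) (G : grading U) (T : lmodType F)
    (w : bool -> F) (f : U -> T) d x :
  linear f -> homog G d x ->
  \sum_(b : bool) w b *: f (dpar G b x) = w (dpr d) *: f x.
Proof.
move=> lf hx; rewrite big_bool !(dparE _ hx).
by case: (dpr d) => /=; rewrite (lin0 lf) scaler0 ?addr0 ?add0r.
Qed.

Lemma bilin_twist (U : vectType F) (G : grading U) (A T : lmodType F)
    (w : bool -> F) (B : U -> A -> T) :
  bilin B -> bilin (fun x y => \sum_(b : bool) w b *: B (dpar G b x) y).
Proof.
move=> [B1 B2]; split=> z a x y /=; rewrite scaler_sumr -big_split /=;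
  apply: eq_bigr => b _.
  by rewrite B1 scalerDr !scalerA mulrC.
by rewrite dpar_linear B2 scalerDr !scalerA mulrC.
Qed.

Lemma actC_bilin p k : bilin (actC GV act p k).
Proof. exact: bilin_twist (act_bilin mod_act). Qed.

Lemma shq_bilin : bilin (shq GV q).
Proof. exact: bilin_twist (lie_bilin lie_q). Qed.

Lemma actCE p k d x m : homog GV d x ->
  actC GV act p k x m
  = (-1) ^+ (odd `|p|%N (+) (dpr d && (odd `|p|%N (+) odd k))) *: act x m.
Proof.
move=> hx.
exact: (dpar_collapse (fun b => (-1) ^+ (odd `|p|%N (+) (b && _))) ((act_bilin mod_act).2 m) hx).
Qed.

Lemma shqE d x y : homog GV d x -> shq GV q x y = (-1) ^+ dpr d *: q x y.
Proof. by move=> hx; apply: (dpar_collapse _ ((lie_bilin lie_q).2 y) hx). Qed.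

(* The terms of shift (dCh c) in which the letters occur in their original
   order; the others are images of these under permutations. *)
Definition actf (p : int) k (C : {ffun 'I_k -> V} -> M) (v : {ffun 'I_k.+1 -> V}) : M :=
  actC GV act p k (v ord0) (C (liftf ord0 v)).

Definition brf k : ({ffun 'I_k -> V} -> M) -> {ffun 'I_k.+1 -> V} -> M :=
  if k is n.+1 then fun C v => C (cons2f (shq GV q) v) else fun _ _ => 0.

Definition dact (p : int) k (c : {ffun 'I_k -> V} -> M) (u : {ffun 'I_k.+1 -> V}) : M :=
  \sum_(i < k.+1) \sum_(e : {ffun 'I_k.+1 -> bool}) (-1) ^+ (odd i (+) (e i && (odd `|p|%N (+) below e i)))
    *: act ([ffun i => par GV (e i) (u i)] i) (c (liftf i [ffun i => par GV (e i) (u i)])).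

(** The sum over parities is moved inside, so that it can be collapsed for each pair separately.
    Since p.1 < p.2, the letter p.2 has index [p.2.-1] once p.1 is removed, and the last exponent
    counts the letters before it other than p.1. *)
Definition dbr n (c : {ffun 'I_n.+1 -> V} -> M) (u : {ffun 'I_n.+2 -> V}) : M :=
  \sum_(p : 'I_n.+2 * 'I_n.+2 | (p.1 < p.2)%N)
   \sum_(e : {ffun 'I_n.+2 -> bool}) (-1) ^+ (odd p.1 (+) odd p.2 (+) (e p.1 && below e p.1)
      (+) (e p.2 && below (liftf p.1 e) p.2.-1))
    *: c (cons2f q (permf (tpair p.1 p.2) [ffun i => par GV (e i) (u i)])).

Lemma dCh0E p (c : {ffun 'I_0 -> V} -> M) : dCh GV q act p c =1 dact p c.
Proof.
move=> u; rewrite /dCh /dact [RHS]exchange_big; apply: eq_bigr => e _ /=.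
rewrite [X in _ + X]big1 ?addr0 => [|i _]; last first.
  by rewrite big1 // => j; rewrite !ord1.
apply: eq_bigr => i _; rewrite -signr_odd; congr (_ ^+ _ *: _).
by rewrite !(oddD, oddM, oddb, odd_sumb) -/(below e i).
Qed.

Lemma dChSE p n (c : {ffun 'I_n.+1 -> V} -> M) :
  dCh GV q act p c =1 fun u => dact p c u + dbr c u.
Proof.
move=> u; rewrite /dCh /dact /dbr exchange_big [X in _ = _ + X]exchange_big -big_split.
apply: eq_bigr => e _ /=; congr (_ + _).
  apply: eq_bigr => i _; rewrite -signr_odd; congr (_ ^+ _ *: _).
  by rewrite !(oddD, oddM, oddb, odd_sumb) -/(below e i).
rewrite pair_big_dep /=; apply: eq_bigr => -[i j] /= ij.
have nij : i != j by apply: contraTneq ij => ->; rewrite ltnn.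
case: (unlift_some nij) => j' Ej _; subst j; rewrite -signr_odd.
have ij' : (i <= j')%N by rewrite -lt_lift.
have ej : (lift i j').-1 = j' by rewrite /= /bump ij'.
congr (_ ^+ _ *: c _).
  rewrite !(oddD, oddM, oddb, odd_sumb) -/(below e i) ej; congr (_ (+) (_ && _)).
  rewrite [LHS]big_mkcond (bigD1_ord i) //= eqxx andbF /below [RHS]big_mkcond.
  apply: eq_bigr => l _; rewrite ffunE eq_sym neq_lift andbT.
  by rewrite /= [in LHS]ltnNge leq_bump2 -ltnNge.
apply/ffunP => l; rewrite ffunE /cons2f tpair_lift ffunE.
case: (unliftP ord0 l) => [l' ->|->] /=; last first.
  by rewrite !ffunE lift_perm_id lift_perm_lift lift_perm_id unlift_none.
rewrite consf_lift !liftf_permf permf1.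
(* Removing [i] first and then [j'] from the rest turns the filtered enumeration into two nested
   lifts. *)
rewrite (eq_filter (a2 := predI (fun l => l != lift i j') (fun l => l != i))); last first.
  by move=> x /=; rewrite andbC.
rewrite filter_predI enum_lift filter_map.
rewrite (eq_filter (a2 := fun l => l != j')) => [|x /=]; last first.
  by rewrite (inj_eq lift_inj).
rewrite enum_lift -map_comp -map_comp add0n (nth_map l') ?size_enum_ord //.
by rewrite nth_ord_enum /= !ffunE.
Qed.

End Cochains.

Section Coboundary.
Variables (F : fieldType) (V M : vectType F) (GV : grading V) (GM : grading M).
Variables (q : V -> V -> V) (act : V -> M -> M).
Hypothesis lie_q : graded_lie GV q.
Hypothesis mod_act : graded_module GV GM q act.

Let parP := fun b d x (hx : homog GV d x) => par_hom b hx.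
Let dparP := @dparE F V GV.
Let ldpar := dpar_linear GV.

Lemma actf_multi p k (C : {ffun 'I_k -> V} -> M) :
  multilinear C -> multilinear (actf GV act p C).
Proof. exact: multi_slot (actC_bilin mod_act p k). Qed.

Lemma brf_multi k (C : {ffun 'I_k -> V} -> M) :
  multilinear C -> multilinear (brf GV q C).
Proof.
case: k C => [|n] C mC; first by move=> u i a x y; rewrite /= scaler0 addr0.
exact: multi_cons2f (shq_bilin lie_q) mC.
Qed.

Lemma dact_multi p k (c : {ffun 'I_k -> V} -> M) :
  multilinear c -> multilinear (dact GV act p c).
Proof.
move=> mc; apply: multi_sum => i _; apply: multi_sum => e _; apply: multiZ.
exact: (multi_map (multi_slot i (act_bilin mod_act) mc) (fun j => par_linear GV (e j))).
Qed.

Lemma dbr_multi n (c : {ffun 'I_n.+1 -> V} -> M) :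
  multilinear c -> multilinear (dbr GV q c).
Proof.
move=> mc; apply: multi_sum => p _; apply: multi_sum => e _; apply: multiZ.
exact: (multi_map (multi_permf (tpair p.1 p.2) (multi_cons2f (lie_bilin lie_q) mc))
  (fun j => par_linear GV (e j))).
Qed.

(** The sign (-1)^i of the coboundary cancels: [below_neg] contributes i (1 + deg x_i), and the
    weight k - i of x_i contributes the missing i deg x_i. Only the Koszul sign of moving x_i to the
    front is left outside [actf]. *)
Lemma shift_dact p k (c : {ffun 'I_k -> V} -> M) : multilinear c ->
  shift GV (dact GV act p c) =1
  fun u => \sum_i pact (dpar GV) (lift_perm ord0 i 1) (actf GV act p (shift GV c)) u.
Proof.
move=> mc; have mC := shift_multi GV mc.
have ma := actf_multi p mC; have md := dact_multi p mc.
apply: (multi_ext (G := GV)) => [||d u hu]; first exact: shift_multi.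
  by apply: multi_sum => i _; apply: pact_multi.
rewrite (shiftE md hu) /dact scaler_sumr; apply: eq_bigr => i _.
have mi := multi_slot i (act_bilin mod_act) mc.
rewrite (big_hpr parP (fun e => (-1) ^+ (odd i (+) (e i && (odd `|p|%N (+) below e i)))) mi hu).
rewrite (pactE dparP _ ma hu) kz_lift0 kz1 addbF.
rewrite /actf liftf_permf permf1 !ffunE lift_perm_id.
rewrite (actCE mod_act _ _ _ (hu i)) (shiftE mc (homog_liftf i hu)).
rewrite (linZ _ _ ((act_bilin mod_act).1 _)) !scalerA -!signr_addb; congr ((-1) ^+ _ *: _).
rewrite hpr_odd below_neg ?(ltnW (ltn_ord i)) // (wt_lift _ i) hpr_liftf !ffunE.
rewrite oddB -1?ltnS // /dpr.
congr nat_of_bool.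
move: (below _ _) (wt _) (odd `|d _|%N) (odd i) (odd k) (odd `|p|%N).
by do 6!case.
Qed.

(** The factor (-1)^(n + 1) is seen on the first pair: one sign is that of the bracket of the
    letters 0 and 1 in [dCh]; the other n come from the bracket, of shifted degree deg x + deg y + 1
    modulo 2, as the first of n + 1 letters and hence of weight n. *)
Lemma shift_dbr n (c : {ffun 'I_n.+1 -> V} -> M) : multilinear c ->
  shift GV (dbr GV q c) =1
  fun u => (-1) ^+ n.+1 *:
    \sum_(p : 'I_n.+2 * 'I_n.+2 | (p.1 < p.2)%N)
      pact (dpar GV) (tpair p.1 p.2) (brf GV q (shift GV c)) u.
Proof.
move=> mc; have mC := shift_multi GV mc.
have mb := brf_multi mC; have md := dbr_multi mc.
apply: (multi_ext (G := GV)) => [||d u hu]; first exact: shift_multi.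
  by apply: multiZ; apply: multi_sum => i _; apply: pact_multi.
rewrite (shiftE md hu) /dbr !scaler_sumr; apply: eq_bigr => -[i j] /= ij.
have nij : i != j by apply: contraTneq ij => ->; rewrite ltnn.
case: (unlift_some nij) => j' Ej _; subst j; rewrite tpair_lift.
have ij' : (i <= j')%N by rewrite -lt_lift.
have ej : bump i j' = j'.+1 by rewrite /bump ij'.
have mt := multi_permf (lift_perm ord0 i (lift_perm ord0 j' 1)) (multi_cons2f (lie_bilin lie_q) mc).
rewrite (big_hpr parP (fun e => (-1) ^+ (odd i (+) odd (bump i j') (+) (e i && below e i)
  (+) (e (lift i j') && below (liftf i e) (bump i j').-1))) mt hu).
rewrite (pactE dparP _ mb hu) !kz_lift0 kz1 addbF ej /=.
have hr := homog_liftf j' (homog_liftf i hu).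
pose d' : {ffun 'I_n.+1 -> int} :=
  [ffun l => oapp (liftf j' (liftf i d)) (d i + d (lift i j')) (unlift ord0 l)].
rewrite /cons2f !liftf_permf permf1 !ffunE lift_perm_id lift_perm_lift lift_perm_id.
rewrite (shqE lie_q _ (hu i)) (linZ _ _ (linear_consf _ mC)).
have hd l : homog GV (d' l) (consf (q (u i) (u (lift i j'))) (liftf j' (liftf i u)) l).
  rewrite !ffunE; case: unliftP => [l' _|_] /=; first exact: hr.
  by apply: (lie_degree lie_q); apply: hu.
rewrite -[_ ^+ n.+1]signr_odd (shiftE mc hd) !scalerA -!signr_addb; congr ((-1) ^+ _ *: _).
rewrite hpr_odd.
have -> : liftf i [ffun i0 => ~~ hpr dpr d i0] = [ffun l => ~~ liftf i (hpr dpr d) l].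
  by apply/ffunP => l; rewrite !ffunE.
rewrite !below_neg ?(ltnW (ltn_ord i)) ?(ltnW (ltn_ord j')) //.
rewrite (wt_lift _ i) (wt_lift (liftf i _) j') (wt_lift (hpr dpr d') ord0) below0.
rewrite (_ : liftf ord0 (hpr dpr d') = liftf j' (liftf i (hpr dpr d))); last first.
  by apply/ffunP => l; rewrite !ffunE liftK /= !ffunE.
rewrite !ffunE unlift_none /= subn0 !oddB -1?ltnS // /dpr odd_absD.
rewrite /=; congr nat_of_bool.
move: (below _ _) (below _ _) (wt _) (odd `|d i|%N) (odd `|d (lift i j')|%N) (odd i) (odd j') (odd n).
by do 8!case.
Qed.
End Coboundary.

(** The transposition of the first two letters, in the form to which [kz_lift0] applies. *)
Definition swap01 n : 'S_n.+2 := lift_perm ord0 (lift ord0 ord0) 1.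

Lemma kz_swap01 n (e : {ffun 'I_n.+2 -> bool}) :
  kz (swap01 n) e = e ord0 && e (lift ord0 ord0).
Proof.
rewrite kz_lift0 kz1 addbF andbC /below big_mkcond big_ord_recl /= big1 ?addbF //.
Qed.

Section CoboundarySym.
Variables (F : fieldType) (V M : vectType F) (GV : grading V) (GM : grading M).
Variables (q : V -> V -> V) (act : V -> M -> M).
Hypothesis lie_q : graded_lie GV q.
Hypothesis mod_act : graded_module GV GM q act.

Let dparP := @dparE F V GV.
Let ldpar := dpar_linear GV.

Lemma actf_stab p k (C : {ffun 'I_k -> V} -> M) :
  multilinear C -> sym_on (dpar GV) (fun=> True) C ->
  sym_on (dpar GV) (fun s => s ord0 = ord0) (actf GV act p C).
Proof.
move=> mC sC s /perm_liftP[t ->] u.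
rewrite (pact_slot ldpar dparP (kz_lift00 t) (actC_bilin mod_act p k) mC).
by rewrite /actf sC.
Qed.

Lemma shqC d e x y : homog GV d x -> homog GV e y ->
  shq GV q y x = (-1) ^+ (dpr d && dpr e) *: shq GV q x y.
Proof.
move=> hx hy; rewrite (shqE lie_q _ hx) (shqE lie_q _ hy) (lie_skew lie_q hx hy).
rewrite scalerN -scaleNr -mulN1r /ksign !scalerA -(signr_addb _ true) -!signr_addb.
by rewrite /dpr; case: odd; case: odd.
Qed.

Lemma brf_stab n (C : {ffun 'I_n.+1 -> V} -> M) :
  multilinear C -> sym_on (dpar GV) (fun=> True) C ->
  sym_on (dpar GV)
    (fun s => (s ord0 = ord0 /\ s (lift ord0 ord0) = lift ord0 ord0) \/ s = swap01 n)
    (brf GV q C).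
Proof.
move=> mC sC s [[s0 s1]|->] u.
  have [t E] := perm_liftP s0; subst s; rewrite lift_perm_lift in s1.
  have [t' E] := perm_liftP (lift_inj s1); subst t.
  by rewrite (pact_cons2f ldpar dparP _ (shq_bilin lie_q) mC) sC.
have mb := brf_multi lie_q mC.
move: u; apply: (multi_ext (G := GV)) => [||d u hu] //; first exact: pact_multi.
rewrite (pactE dparP _ mb hu) kz_swap01 /= /cons2f !liftf_permf.
rewrite ![permf _ u _]ffunE lift_perm_id.
have -> : swap01 n (lift ord0 ord0) = ord0.
  by rewrite lift_perm_lift perm1; apply: val_inj.
have -> : permf 1 (liftf (lift ord0 ord0) u) = liftf (lift ord0 ord0) u by exact: permf1.
have -> : liftf ord0 (liftf (lift ord0 ord0) u) = liftf ord0 (liftf ord0 u).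
  by apply/ffunP => l; rewrite !ffunE; congr (u _); apply: val_inj.
rewrite (shqC (hu ord0) (hu _)) (linZ _ _ (linear_consf _ mC)) scalerA -signr_addb.
by rewrite !ffunE addbb scale1r.
Qed.

Lemma sym_onD n (f g : {ffun 'I_n -> V} -> M) S :
  sym_on (dpar GV) S f -> sym_on (dpar GV) S g ->
  sym_on (dpar GV) S (fun u => f u + g u).
Proof. by move=> sf sg s Ss u; rewrite pactD sf // sg. Qed.

Lemma sym_onZ n (f : {ffun 'I_n -> V} -> M) S a :
  sym_on (dpar GV) S f -> sym_on (dpar GV) S (fun u => a *: f u).
Proof. by move=> sf s Ss u; rewrite pactZ sf. Qed.

Lemma eq_sym_on n (f g : {ffun 'I_n -> V} -> M) S :
  f =1 g -> sym_on (dpar GV) S g -> sym_on (dpar GV) S f.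
Proof. by move=> fg sg s Ss u; rewrite (eq_pact _ _ fg) sg. Qed.

Definition brsum k : ({ffun 'I_k -> V} -> M) -> {ffun 'I_k.+1 -> V} -> M :=
  if k is n.+1 then fun C u =>
    \sum_(p : 'I_n.+2 * 'I_n.+2 | (p.1 < p.2)%N)
      pact (dpar GV) (tpair p.1 p.2) (brf GV q C) u
  else fun _ _ => 0.

Lemma shift_dCh p k (c : {ffun 'I_k -> V} -> M) : multilinear c ->
  shift GV (dCh GV q act p c) =1
  fun u => \sum_i pact (dpar GV) (lift_perm ord0 i 1) (actf GV act p (shift GV c)) u
           + (-1) ^+ k *: brsum (shift GV c) u.
Proof.
move=> mc u; rewrite shiftP.
case: k c mc u => [|n] c mc u.
  under eq_bigr do rewrite dCh0E.
  by rewrite -shiftP (shift_dact mod_act) // scaler0 addr0.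
under eq_bigr do rewrite dChSE scalerDr.
by rewrite big_split /= -!shiftP (shift_dact mod_act) // (shift_dbr lie_q).
Qed.

Lemma dCh_multi p k (c : {ffun 'I_k -> V} -> M) :
  multilinear c -> multilinear (dCh GV q act p c).
Proof.
case: k c => [|n] c mc u i a x y.
  by rewrite !dCh0E (dact_multi mod_act).
by rewrite !dChSE (dact_multi mod_act) // (dbr_multi lie_q) // scalerDr addrACA.
Qed.

(** Each sum in [shift_dCh] runs over the cosets of the stabilizer of its summand: that of the first
    slot for [actf], that of the unordered pair of the first two for [brf]. *)
Lemma shift_dCh_sym p k (c : {ffun 'I_k -> V} -> M) :
  multilinear c -> skewsymmetric GV c ->
  sym_on (dpar GV) (fun=> True) (shift GV (dCh GV q act p c)).
Proof.
move=> mc sc; have mC := shift_multi GV mc; have sC := shift_sym mc sc.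
apply: (eq_sym_on (shift_dCh p mc)); apply: sym_onD.
  apply: (orbit_sum_sym ldpar dparP (z := ord0)) => [|i|]; first exact: (actf_multi mod_act).
    exact: lift_perm_id.
  exact: actf_stab.
apply: sym_onZ; case: k c mc sc mC sC => [|n] c mc sc mC sC.
  by move=> s _ u; rewrite /= /pact big1 // => e _; apply: scaler0.
apply: (orbit_pair_sum_sym ldpar dparP (z := ord0) (z' := lift ord0 ord0)
         (t := @tpair n) (w := swap01 n)).
- exact: (brf_multi lie_q).
- exact: tpairE.
- exact: lift_perm_id.
- by rewrite lift_perm_lift perm1; apply: val_inj.
exact: brf_stab.
Qed.
End CoboundarySym.

(** * The pairing on the double *)

Lemma sum_bool (T : nmodType) (f : bool -> T) : \sum_b f b = f true + f false.
Proof. by rewrite big_bool. Qed.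

Section ParProdDual.
Variables (F : fieldType) (U1 U2 : vectType F) (G1 : grading U1) (G2 : grading U2).

Lemma par_prod b (w : U1 * U2) :
  par (prod_grading G1 G2) b w = (par G1 b w.1, par G2 b w.2).
Proof.
move: w; apply: (linear_homog (G := prod_grading G1 G2)) => [|a x y|d w hw].
- exact: par_linear.
- by rewrite /= !par_linear.
rewrite (par_hom _ hw); case: w hw => x y [hx hy] /=.
by rewrite (par_hom b hx) (par_hom b hy); case: ifP.
Qed.

Lemma homog_prod d (w : U1 * U2) :
  homog G1 d w.1 -> homog G2 d w.2 -> homog (prod_grading G1 G2) d w.
Proof. by case: w => x y; rewrite /homog /= /homog => -> ->. Qed.

Lemma homog_fst d (w : U1 * U2) : homog (prod_grading G1 G2) d w -> homog G1 d w.1.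
Proof. by case: w => x y []. Qed.

Lemma homog_snd d (w : U1 * U2) : homog (prod_grading G1 G2) d w -> homog G2 d w.2.
Proof. by case: w => x y []. Qed.

Lemma dual_homog d e (f : 'Hom(U1, F^o)) x :
  homog (dual_grading G1) d f -> homog G1 e x -> e != - d -> f x = 0.
Proof.
move=> hf hx ne; rewrite -hf /= comp_lfunE hclE (hcomp_hom _ hx) eq_sym (negPf ne).
by rewrite linear0.
Qed.

Lemma par_dual b (f : 'Hom(U1, F^o)) x : par (dual_grading G1) b f x = f (par G1 b x).
Proof.
move: f; apply: (linear_homog (G := dual_grading G1) (f := fun f => _) (g := fun f => _)).
- by move=> a f g; rewrite par_linear add_lfunE scale_lfunE.
- by move=> a f g; rewrite add_lfunE scale_lfunE.
move=> d f hf; rewrite (par_hom _ hf); move: x.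
apply: (linear_homog (G := G1)) => [a x y|a x y|e x hx].
- by rewrite linearP.
- by rewrite par_linear linearP.
rewrite (par_hom _ hx); case: (eqVneq e (- d)) => [->|ne].
  by rewrite abszN; case: ifP; rewrite ?zero_lfunE ?linear0.
have f0 := dual_homog hf hx ne.
by case: ifP; case: ifP; rewrite ?zero_lfunE ?linear0 ?f0.
Qed.
End ParProdDual.

Lemma parK (F : fieldType) (U : vectType F) (G : grading U) b b' x :
  par G b (par G b' x) = if b == b' then par G b x else 0.
Proof.
move: x; apply: (linear_homog (G := G)) => [a x y|a x y|d x hx].
- by rewrite !par_linear.
- by case: ifP => _; rewrite ?par_linear // scaler0 addr0.
rewrite !(par_hom _ hx); move E: (odd `|d|%N) => o.
by case: b b' o E => [] [] [] E /=;
  rewrite ?(lin0 (par_linear G _)) ?(par_hom _ hx) ?E.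
Qed.

Section Pairing.
Variables (F : fieldType) (V M : vectType F) (GV : grading V) (GM : grading M).

Local Notation D := (dbl V M).
Local Notation GD := (graddbl GV GM).
Local Notation GW := (gradW GV GM).
Local Notation GW' := (gradW' GV GM).
Implicit Types (u v z : D).

Definition sgW (w : V * M) : V * M := \sum_(b : bool) (-1) ^+ b *: par GW b w.

Lemma evW_bilin : bilin (@evW F V M).
Proof.
split=> [f a x y|x a f g]; rewrite /evW /=.
  by rewrite !linearP /= scalerDr addrACA.
by rewrite !add_lfunE !scale_lfunE scalerDr addrACA.
Qed.

Lemma evW_par b f w : evW (par GW' b f) w = evW f (par GW b w).
Proof. by rewrite /evW !par_prod /= !par_dual. Qed.

(** A nonzero pairing forces [f] and [w] to have the same parity, so the sign of their exchange
    depends on [w] alone. *)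
Lemma kflip_evW w f : kflip GW GW' (@evW F V M) w f = evW f (sgW w).
Proof.
have [e1 e2] := evW_bilin.
rewrite /kflip /sgW (lin_sum _ _ _ (e1 _)); apply: eq_bigr => b _.
rewrite (linZ _ _ (e1 _)) sum_bool !evW_par !parK; case: b => /=.
  by rewrite (lin0 (e1 _)) scaler0 addr0.
by rewrite (lin0 (e1 _)) scaler0 add0r.
Qed.

Lemma sgW_linear : linear sgW.
Proof.
by move=> a x y; rewrite /sgW !sum_bool !par_linear !scalerDr !scalerA ![a * _]mulrC addrACA.
Qed.

Lemma sgW_par b w : sgW (par GW b w) = (-1) ^+ b *: par GW b w.
Proof.
by rewrite /sgW sum_bool !parK; case: b; rewrite /= scaler0 ?addr0 ?add0r.
Qed.

Lemma sgWK w : sgW (sgW w) = w.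
Proof.
rewrite {2}/sgW (lin_sum _ _ _ sgW_linear) sum_bool !(linZ _ _ sgW_linear) !sgW_par.
by rewrite !scalerA -!signr_addb !scale1r addrC par_sum.
Qed.

Lemma btE u v : bt GV GM u v = evW u.2 v.1 + evW v.2 (sgW u.1).
Proof. by rewrite /bt kflip_evW. Qed.

Lemma bt_bilin : bilin (bt GV GM).
Proof.
have [e1 e2] := evW_bilin.
split=> [u a x y|y a u v]; rewrite /= !btE /=.
  by rewrite e1 e2 addrACA -scalerDr.
by rewrite sgW_linear e1 e2 addrACA -scalerDr.
Qed.

Lemma par_dbl b u : par GD b u = (par GW b u.1, par GW' b u.2).
Proof. exact: par_prod. Qed.

(** [bt] is graded symmetric and pairs letters of equal parity, so exchanging them costs (-1)^|u|,
    the opposite of (-1)^(deg u). This removes the parity sum from [Bt]. *)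
Lemma BtE u v : Bt GV GM u v = - bt GV GM v u.
Proof.
have [e1 e2] := evW_bilin.
rewrite /Bt sum_bool !btE /dpar !par_dbl /= !sgW_par !evW_par.
rewrite (linZ _ _ (e1 _)) -[sgW v.1]/(\sum_b _) sum_bool (linD _ _ (e1 _)).
rewrite !(linZ _ _ (e1 _)) !scaleN1r !scale1r.
rewrite -[in RHS](par_sum GW u.1) (linD _ _ (e1 _)).
move: (evW _ _) (evW _ _) (evW _ _) (evW _ _) => a b c d.
by rewrite !opprD !opprK; ring.
Qed.

Lemma Bt_bilin : bilin (Bt GV GM).
Proof.
have [b1 b2] := bt_bilin; split=> [u a x y|y a u v] /=.
  by rewrite !BtE b2 opprD scalerN.
by rewrite !BtE b1 opprD scalerN.
Qed.

Lemma functional_sep (U : vectType F) (x : U) : (forall f : 'Hom(U, F^o), f x = 0) -> x = 0.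
Proof.
move=> fx; rewrite (coord_vbasis (memvf x)) big1 // => i _.
have := fx (linfun (coord (vbasis fullv) i : U -> F^o)).
by rewrite lfunE /= => ->; rewrite scale0r.
Qed.

Lemma bt_nondeg z : (forall u, bt GV GM u z = 0) -> z = 0.
Proof.
move=> bz; have [e1 e2] := evW_bilin.
have z1 f : evW f z.1 = 0.
  have := bz (0, f); rewrite btE /= (lin0 sgW_linear) (lin0 (e1 _)) addr0.
  by [].
have z2 w : evW z.2 w = 0.
  by have := bz (sgW w, 0); rewrite btE /= sgWK (lin0 (e2 _)) add0r.
case: z z1 z2 {bz} => [[x a] [g h]] /= z1 z2.
congr ((_, _), (_, _)).
- by apply: functional_sep => f; have := z1 (f, 0); rewrite /evW /= zero_lfunE addr0.
- by apply: functional_sep => f; have := z1 (0, f); rewrite /evW /= zero_lfunE add0r.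
- by apply/lfunP => y; have := z2 (y, 0); rewrite /evW /= linear0 addr0 zero_lfunE.
- by apply/lfunP => y; have := z2 (0, y); rewrite /evW /= linear0 add0r zero_lfunE.
Qed.

(** Transfers multilinearity and symmetry from the form [Phi] to the map [tildeC]. *)
Lemma Bt_inj z z' : (forall v, Bt GV GM z v = Bt GV GM z' v) -> z = z'.
Proof.
move=> E; apply/eqP; rewrite -subr_eq0; apply/eqP; apply: bt_nondeg => v.
have [b1 b2] := bt_bilin.
rewrite (linD _ _ (b1 _)) (linN _ (b1 _)); apply/eqP; rewrite subr_eq0 -eqr_opp -!BtE.
by rewrite E.
Qed.

Lemma bt_homog d e u v : homog GD d u -> homog GD e v -> d + e != 0 ->
  bt GV GM u v = 0.
Proof.
move=> hu hv de; have [e1 e2] := evW_bilin.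
have ev0 d' e' f w : homog GW' d' f -> homog GW e' w -> d' + e' != 0 -> evW f w = 0.
  move=> hf hw ne; have ne' : e' != - d' by rewrite -addr_eq0 addrC.
  rewrite /evW (dual_homog (homog_fst hf) (homog_fst hw) ne').
  by rewrite (dual_homog (homog_snd hf) (homog_snd hw) ne') addr0.
rewrite btE (ev0 _ _ _ _ (homog_snd hu) (homog_fst hv) de) add0r.
rewrite /sgW (lin_sum _ _ _ (e1 _)) big1 // => b _; rewrite (linZ _ _ (e1 _)).
rewrite (ev0 _ _ _ _ (homog_snd hv) (homog_par b (homog_fst hu))) ?scaler0 //.
by rewrite addrC.
Qed.

(** By nondegeneracy the degree of a vector can be read off its pairings; this gives the degree of
    [tildeC] from that of [Phi]. *)
Lemma homog_bt e v :
  (forall d u, homog GD d u -> d + e != 0 -> bt GV GM u v = 0) -> homog GD e v.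
Proof.
move=> H; apply/eqP; rewrite -subr_eq0; apply/eqP; apply: bt_nondeg => u.
have [b1 b2] := bt_bilin.
rewrite (linD _ _ (b1 _)) (linN _ (b1 _)); apply/eqP; rewrite subr_eq0; apply/eqP.
move: u; apply: (linear_homog (G := GD)) => // d u hu.
case: (eqVneq (d + e) 0) => [de|ne]; last first.
  by rewrite (H d) // (bt_homog hu (homog_hcomp _ _ _) ne).
rewrite -[in RHS](hcomp_sum GD v) (lin_sum _ _ _ (b1 _)).
(* Against [u] of degree -e only the component of degree e of [v] contributes. *)
rewrite [RHS](eq_bigr (fun i => if i == e then bt GV GM u (hcomp GD e v) else 0)); last first.
  move=> i _; case: eqVneq => [-> //|ne].
  apply: (bt_homog hu (homog_hcomp _ _ _)); apply: contra ne => /eqP E.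
  by apply/eqP; apply: (addrI d); rewrite E de.
rewrite -big_mkcond; case: (boolP (e \in hdegs GD)) => [ein|eN].
  by rewrite -big_filter filter_pred1_uniq ?hdegs_uniq // big_seq1.
by rewrite hcomp_out // (lin0 (b1 _)) big1.
Qed.
End Pairing.

(** * The map Phi *)

Section Rotation.

Lemma rot1X n m (i : 'I_n.+1) : (rot1 n.+1 ^+ m)%g i = ((i + m) %% n.+1)%N :> nat.
Proof.
rewrite permX; elim: m => [|m IH] /=; first by rewrite addn0 modn_small.
by rewrite permE /= IH -addn1 modnDml addn1 addnS.
Qed.

(** The exponent is i + 1 because the last slot has index n, and n + i + 1 is i modulo n + 1.
    Rotations are thus indexed by the letter they put last. *)
Lemma rotXS_max n (i : 'I_n.+1) : (rot1 n.+1 ^+ i.+1)%g ord_max = i.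
Proof.
by apply: val_inj; rewrite /= rot1X /= addnS -addSn modnDl modn_small.
Qed.

Lemma sum_rot (T : nmodType) n (g : 'S_n.+1 -> T) :
  \sum_(s in <[rot1 n.+1]>%g) g s = \sum_(i < n.+1) g (rot1 n.+1 ^+ i.+1)%g.
Proof.
have inj : injective (fun i : 'I_n.+1 => (rot1 n.+1 ^+ i.+1)%g).
  by move=> i j /= E; rewrite -(rotXS_max i) E rotXS_max.
transitivity (\sum_(s in (fun i : 'I_n.+1 => (rot1 n.+1 ^+ i.+1)%g) @: [set: 'I_n.+1]) g s); last first.
  rewrite big_imset => [|i j _ _]; last exact: inj.
  by apply: eq_bigl => i; rewrite inE.
apply: eq_bigl => s; apply/idP/imsetP => [/cycleP[m ->]|[i _ ->]]; last exact: mem_cycle.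
(* The index i representing the exponent m must satisfy i + 1 = m modulo n + 1, hence i = m + n. *)
have lt : ((m + n) %% n.+1 < n.+1)%N by rewrite ltn_mod.
exists (Ordinal lt) => //; apply/permP => i; apply: val_inj.
rewrite /= !rot1X /= -[(_ %% _).+1]addn1 addnA -[RHS]modnDml modnDmr [RHS]modnDml.
by rewrite addnA -[(_ + n + 1)%N]addnA addn1 modnDr.
Qed.
End Rotation.

Section PhiMap.
Variables (F : fieldType) (V M : vectType F) (GV : grading V) (GM : grading M).

Local Notation D := (dbl V M).
Local Notation GD := (graddbl GV GM).
Let dparP := @dparE F D GD.
Let ldpar := dpar_linear GD.

Definition evM (z : D) (m : M) : F^o := z.2.2 m.

Lemma evM_bilin : bilin evM.
Proof.
split=> [z a x y|m a z w]; rewrite /evM /=; first by rewrite linearP.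
by rewrite add_lfunE scale_lfunE.
Qed.

Lemma fstfst_linear : linear (fun z : D => z.1.1).
Proof. by []. Qed.

Lemma dpar_fstfst b (z : D) : (dpar GD b z).1.1 = dpar GV b z.1.1.
Proof. by rewrite /dpar !par_prod. Qed.

(** For [C = shift GV c] this is [hC c]. Leaving [C] arbitrary lets the same form carry the terms
    [actf] and [brf] of the coboundary. *)
Definition ext k (C : {ffun 'I_k -> V} -> M) (u : {ffun 'I_k.+1 -> D}) : F^o :=
  evM (u ord_max) (C (xpart (liftf ord_max u))).

Lemma xpart_multi k (T : lmodType F) (C : {ffun 'I_k -> V} -> T) :
  multilinear C -> multilinear (fun u : {ffun 'I_k -> D} => C (xpart u)).
Proof. exact: (multi_comp fstfst_linear). Qed.

Lemma ext_multi k (C : {ffun 'I_k -> V} -> M) : multilinear C -> multilinear (ext C).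
Proof. by move=> mC; apply: (multi_slot ord_max evM_bilin (xpart_multi mC)). Qed.

Lemma pact_ext k (C : {ffun 'I_k -> V} -> M) (s : 'S_k) : multilinear C ->
  pact (dpar GD) (lift_perm ord_max ord_max s) (ext C) =1 ext (pact (dpar GV) s C).
Proof.
move=> mC u.
rewrite (pact_slot ldpar dparP (kz_liftmm s) evM_bilin (xpart_multi mC)).
congr (evM _ _); apply: (pact_comp (L := fun z : D => z.1.1)); exact: dpar_fstfst.
Qed.

Lemma ext_stab k (C : {ffun 'I_k -> V} -> M) :
  multilinear C -> sym_on (dpar GV) (fun=> True) C ->
  sym_on (dpar GD) (fun s => s ord_max = ord_max) (ext C).
Proof.
by move=> mC sC s /perm_liftP[t ->] u; rewrite pact_ext // /ext sC.
Qed.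

Lemma eq_ext k (C C' : {ffun 'I_k -> V} -> M) : C =1 C' -> ext C =1 ext C'.
Proof. by move=> E u; rewrite /ext E. Qed.

(* psi (shift c) turns out to be - Phi c. *)
Definition psi k (C : {ffun 'I_k -> V} -> M) (u : {ffun 'I_k.+1 -> D}) : F^o :=
  \sum_(i < k.+1) pact (dpar GD) (rot1 k.+1 ^+ i.+1)%g (ext C) u.

Lemma CyclE n (f : {ffun 'I_n.+1 -> D} -> F^o) u :
  Cycl GD f u = \sum_(i < n.+1) pact (dpar GD) (rot1 n.+1 ^+ i.+1)%g f u.
Proof. by rewrite /Cycl sum_rot. Qed.

Lemma psi_multi k (C : {ffun 'I_k -> V} -> M) : multilinear C -> multilinear (psi C).
Proof.
by move=> mC; apply: multi_sum => i _; apply: pact_multi => //; apply: ext_multi.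
Qed.

Lemma psi_sym k (C : {ffun 'I_k -> V} -> M) :
  multilinear C -> sym_on (dpar GV) (fun=> True) C ->
  sym_on (dpar GD) (fun=> True) (psi C).
Proof.
move=> mC sC; apply: (orbit_sum_sym ldpar dparP (z := ord_max)).
- exact: ext_multi.
- exact: rotXS_max.
exact: ext_stab.
Qed.

Lemma Om_Cprime k (c : {ffun 'I_k -> V} -> M) u :
  Om GV GM (Cprime GV c) u = - ext (shift GV c) u.
Proof.
rewrite /Om BtE btE /= /Cprime /ext /evM /evW /= !linear0 !add0r.
by rewrite !zero_lfunE !addr0.
Qed.

(** When the last letter does not fill the slot of h, only its component in V enters. This is why
    [gtilde] may be evaluated on letters (y, 0, 0, 0). *)
Lemma pact_ext_last k (C : {ffun 'I_k -> V} -> M) (s : 'S_k.+1) u (z z' : D) :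
  multilinear C -> s ord_max != ord_max -> z.1.1 = z'.1.1 ->
  pact (dpar GD) s (ext C) (snocf u z) = pact (dpar GD) s (ext C) (snocf u z').
Proof.
move=> mC smax zz'.
have mp := pact_multi ldpar s (ext_multi mC).
have l := linear_snocf u mp.
rewrite -[z](subrK z') (linD _ _ l) -[RHS]add0r; congr (_ + _).
rewrite pactP big1 // => e _; rewrite /ext /=.
set v := permf _ _.
(* Slot [j] of [C] receives the last letter, here [z - z'], whose component in V is 0. *)
have [j Ej] : exists j, s (lift ord_max j) = ord_max.
  have : (s^-1)%g ord_max != ord_max.
    by apply: contra smax => /eqP E; have := permKV s ord_max; rewrite E => ->.
  by rewrite eq_sym => /unlift_some[j E _]; exists j; rewrite -E permKV.
rewrite (multi0 (i := j) mC) ?(lin0 (evM_bilin.1 _)) ?scaler0 //.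
rewrite !ffunE Ej unlift_none /= dpar_fstfst /= zz' subrr.
exact: (lin0 (dpar_linear GV _)).
Qed.
End PhiMap.

Section TildeC.
Variables (F : fieldType) (V M : vectType F) (GV : grading V) (GM : grading M).

Local Notation D := (dbl V M).
Local Notation GD := (graddbl GV GM).
Let dparP := @dparE F D GD.
Let ldpar := dpar_linear GD.

Definition sgV (y : V) : V := \sum_(b : bool) (-1) ^+ b *: par GV b y.

Lemma sgW_fst (w : V * M) : (sgW GV GM w).1 = sgV w.1.
Proof. by rewrite /sgW /sgV !sum_bool /= !par_prod. Qed.

Lemma sgV_linear : linear sgV.
Proof.
move=> a x y; have := sgW_linear GV GM a (x, 0) (y, 0).
by move=> /(congr1 (fun w : V * M => w.1)) /=; rewrite !sgW_fst.
Qed.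

Lemma sgVK y : sgV (sgV y) = y.
Proof. by have := sgWK GV GM (y, 0) => /(congr1 fst); rewrite !sgW_fst. Qed.

Definition inV (y : V) : D := ((y, 0), 0).

Lemma inV_linear : linear inV.
Proof.
move=> a x y; rewrite /inV; congr ((_, _), _) => /=; first by rewrite scaler0 addr0.
by rewrite scaler0 addr0.
Qed.

Section Cochain.
Variables (k : nat) (c : {ffun 'I_k -> V} -> M).
Hypothesis mc : multilinear c.
Let C := shift GV c.
Let mC : multilinear C := shift_multi GV mc.

Let g0 (u : {ffun 'I_k -> D}) (z : D) : F^o :=
  \sum_(j < k) pact (dpar GD) (rot1 k.+1 ^+ j.+1)%g (ext C) (snocf u z).

Let g0_linear u : linear (g0 u).
Proof.
move=> a x y; rewrite /g0 scaler_sumr -big_split; apply: eq_bigr => j _.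
by rewrite (linear_snocf _ (pact_multi ldpar _ (ext_multi mC))).
Qed.

(** The sign - (-1)^(deg y) of [gtilde] is (-1)^|y|. It cancels in [Phi_psi] against the sign that
    [bt] puts on its first argument. *)
Lemma gtildeE u y : gtilde GV GM c u y = g0 u (inV (sgV y)).
Proof.
have ls : linear (fun y => g0 u (inV y)) by move=> a x z; rewrite inV_linear g0_linear.
rewrite /gtilde /sgV !sum_bool (linD _ _ ls) !(linZ _ _ ls).
rewrite -!/(inV _) -!/(g0 u _) /dpar /= scaleN1r !scale1r opprD opprK.
by rewrite addrC scaleN1r.
Qed.

Lemma gtilde_linear u : linear (gtilde GV GM c u).
Proof. by move=> a x y; rewrite !gtildeE sgV_linear inV_linear g0_linear. Qed.

(** The last of the k + 1 rotations is a full turn and comes from the component of [tildeC] in M;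
    the other k make up the component in the dual of V. *)
Lemma Phi_psi u : Phi GV GM c u = - psi GV GM C u.
Proof.
rewrite /Phi /Om BtE btE /=; congr (- _).
rewrite /evW /= linear0 add0r zero_lfunE addr0 sgW_fst (linfunE' (gtilde_linear _)).
rewrite gtildeE sgVK /psi big_ord_recr /= addrC; congr (_ + _).
  have -> : (rot1 k.+1 ^+ k.+1 = 1)%g.
    by apply/permP => i; apply: val_inj; rewrite /= rot1X perm1 modnDr modn_small.
  by rewrite (pact1 ldpar dparP (ext_multi mC)).
apply: eq_bigr => j _; rewrite -[in RHS](snocf_eta u).
apply: (pact_ext_last _ _ _ mC) => //.
have -> : j.+1 = (widen_ord (leqnSn k) j).+1 by [].
by rewrite rotXS_max; apply: contraTneq (ltn_ord j) => /(congr1 val) /= ->; rewrite ltnn.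
Qed.

Lemma Phi_Cycl u : Phi GV GM c u = Cycl GD (Om GV GM (Cprime GV c)) u.
Proof.
rewrite Phi_psi CyclE /psi -sumrN; apply: eq_bigr => i _.
rewrite (eq_pact _ _ (Om_Cprime GV GM c)) -scaleN1r -pactZ; apply: eq_pact => v.
by rewrite scaleN1r.
Qed.

Lemma Phi_multi : multilinear (Phi GV GM c).
Proof.
by move=> u i a x y; rewrite !Phi_psi (psi_multi GV GM mC) opprD scalerN.
Qed.

Lemma Bt_tildeC u v : Bt GV GM (tildeC GV GM c u) v = Phi GV GM c (snocf u v).
Proof. by rewrite /Phi /Om initf_snocf snocf_max. Qed.

Lemma tildeC_multi : multilinear (tildeC GV GM c).
Proof.
have [B1 B2] := Bt_bilin GV GM.
move=> u i a x y; apply: (@Bt_inj _ _ _ GV GM) => v.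
by rewrite B2 !Bt_tildeC -!upd_snocf Phi_multi.
Qed.

Hypothesis sc : skewsymmetric GV c.
Let sC := shift_sym mc sc.

Lemma Phi_sym : sym_on (dpar GD) (fun=> True) (Phi GV GM c).
Proof.
move=> s _ u; rewrite Phi_psi -(psi_sym GM mC sC (s := s)) // -scaleN1r -pactZ.
by apply: eq_pact => v; rewrite Phi_psi scaleN1r.
Qed.

Lemma pact_snocf (f : {ffun 'I_k.+1 -> D} -> F^o) (s : 'S_k) u v :
  multilinear f ->
  pact (dpar GD) s (fun u => f (snocf u v)) u
  = pact (dpar GD) (lift_perm ord_max ord_max s) f (snocf u v).
Proof.
move=> mf; have mfv := multi_snocf v mf; have mp := pact_multi ldpar (lift_perm ord_max ord_max s) mf.
move: u; apply: (multi_ext (G := GD)) => [||d u hu].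
- exact: pact_multi.
- exact: multi_snocf.
rewrite (pactE dparP _ mfv hu); move: v {mfv}.
apply: (linear_homog (G := GD)) => [||e v hv].
- by move=> a x y; rewrite (linear_snocf _ mf) scalerDr !scalerA mulrC.
- exact: linear_snocf.
pose d' : {ffun 'I_k.+1 -> int} := [ffun i => oapp d e (unlift ord_max i)].
have hd i : homog GD (d' i) (snocf u v i).
  by rewrite !ffunE; case: unliftP => [j _|_] /=; [apply: hu | apply: hv].
rewrite (pactE dparP _ mf hd) kz_liftmm -hpr_liftf.
rewrite (_ : liftf ord_max d' = d); last by apply/ffunP => i; rewrite !ffunE liftK.
congr (_ *: f _); apply/ffunP => i; rewrite !ffunE.
case: (unliftP ord_max i) => [j ->|->]; rewrite ?lift_perm_id ?lift_perm_lift.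
  by rewrite liftK /= ffunE.
by rewrite unlift_none.
Qed.

Lemma tildeC_sym : symmetric_shifted GD (tildeC GV GM c).
Proof.
have [B1 B2] := Bt_bilin GV GM.
move=> s u; apply: (@Bt_inj _ _ _ GV GM) => v.
rewrite -(pact_post _ _ _ _ (B2 v)) Bt_tildeC -(Phi_sym (s := lift_perm ord_max ord_max s)) //.
rewrite -(pact_snocf _ _ _ Phi_multi); apply: eq_pact => w; exact: Bt_tildeC.
Qed.

Lemma tildeC_quadratic : quadratic GV GM (tildeC GV GM c).
Proof. by move=> u; apply: (Phi_sym (s := rot1 k.+1)). Qed.

Variable p : int.
Hypothesis dc : has_degree GV GM c p.

Lemma shift_degree : has_degree GV GM C p.
Proof.
move=> d u hu; pose d' : {ffun 'I_k -> int} := [ffun i => d i].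
rewrite /C (shiftE (d := d') mc); last by move=> i; rewrite ffunE.
exact/homogZ/dc.
Qed.

Lemma ext_degree (d : {ffun 'I_k.+1 -> int}) (u : {ffun 'I_k.+1 -> D}) :
  (forall i, homog GD (d i) (u i)) -> \sum_i d i + p != 0 -> ext C u = 0.
Proof.
move=> hu dp.
have hC : homog GM (\sum_i d (lift ord_max i) + p) (C (xpart (liftf ord_max u))).
  apply: (shift_degree (d := fun i => d (lift ord_max i))) => i; rewrite !ffunE.
  exact: homog_fst (homog_fst (hu _)).
apply: (dual_homog (homog_snd (homog_snd (hu ord_max))) hC).
apply: contra dp => /eqP E; rewrite (bigD1_ord ord_max) //= -addrA E.
by rewrite subrr.
Qed.

Lemma Phi_degree (d : {ffun 'I_k.+1 -> int}) (u : {ffun 'I_k.+1 -> D}) :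
  (forall i, homog GD (d i) (u i)) -> \sum_i d i + p != 0 -> Phi GV GM c u = 0.
Proof.
move=> hu dp; rewrite Phi_psi /psi big1 ?oppr0 // => i _.
rewrite (pactE dparP _ (ext_multi mC) hu) (ext_degree (d := permf (rot1 k.+1 ^+ i.+1)%g d)) ?scaler0 //.
  by move=> j; rewrite !ffunE.
rewrite (_ : \sum_j _ = \sum_j d j) // [RHS](reindex_inj (@perm_inj _ (rot1 k.+1 ^+ i.+1)%g)).
by apply: eq_bigr => j _; rewrite ffunE.
Qed.

(** In unshifted degrees the value must have degree [\sum_i d i + p]; tested by pairing with a
    letter [v], this is the vanishing stated in [Phi_degree]. *)
Lemma tildeC_degree :
  has_shifted_degree GD GD (tildeC GV GM c) (p + k%:Z - 1).
Proof.
move=> d u hu; apply: homog_bt => e v hv ne.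
apply: oppr_inj; rewrite -BtE oppr0 Bt_tildeC.
pose d' : {ffun 'I_k.+1 -> int} := [ffun i => oapp d e (unlift ord_max i)].
apply: (Phi_degree (d := d')).
  by move=> i; rewrite !ffunE; case: unliftP => [j _|_] /=; [apply: hu | apply: hv].
apply: contra ne => /eqP E; apply/eqP; rewrite -[RHS]E (bigD1_ord ord_max) //= ffunE unlift_none /=.
rewrite sumrB sumr_const card_ord.
under [in RHS]eq_bigr do rewrite ffunE liftK /=.
by rewrite -[k%:Z]natz; ring.
Qed.
End Cochain.
End TildeC.

(** * The Pinczon bracket with the form of the Lie bracket *)

Section QtStructure.
Variables (F : fieldType) (V M : vectType F) (GV : grading V) (GM : grading M).
Variables (q : V -> V -> V) (act : V -> M -> M).
Hypothesis lie_q : graded_lie GV q.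
Hypothesis mod_act : graded_module GV GM q act.

Local Notation D := (dbl V M).
Local Notation GD := (graddbl GV GM).
Local Notation GW := (gradW GV GM).
Local Notation GW' := (gradW' GV GM).

Lemma bilin_sum (A B T : lmodType F) (I : Type) (r : seq I) (f : I -> A -> B -> T) :
  (forall i, bilin (f i)) -> bilin (fun x y => \sum_(i <- r) f i x y).
Proof.
move=> bf; split=> [x a y z|z a x y] /=; rewrite scaler_sumr -big_split /=;
  apply: eq_bigr => i _; [exact: (bf i).1 | exact: (bf i).2].
Qed.

Lemma bilinZ (A B T : lmodType F) b (f : A -> B -> T) :
  bilin f -> bilin (fun x y => b *: f x y).
Proof.
by move=> [f1 f2]; split=> [x a y z|z a x y] /=; rewrite ?f1 ?f2 scalerDr !scalerA [b * a]mulrC.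
Qed.

Lemma bilin_comp (A A' B B' T : lmodType F) (f : A -> B -> T) (g : A' -> A) (h : B' -> B) :
  bilin f -> linear g -> linear h -> bilin (fun x y => f (g x) (h y)).
Proof.
by move=> [f1 f2] lg lh; split=> [x a y z|z a x y] /=; rewrite ?lh ?lg ?f1 ?f2.
Qed.

Lemma bilinC (A B T : lmodType F) (f : A -> B -> T) : bilin f -> bilin (fun y x => f x y).
Proof. by case=> f1 f2; split. Qed.

Lemma kflip_bilin (A B : vectType F) (GA : grading A) (GB : grading B)
    (T : lmodType F) (f : B -> A -> T) :
  bilin f -> bilin (kflip GA GB f).
Proof.
move=> bf; apply: bilin_sum => b; apply: bilin_sum => b'; apply: bilinZ.
exact: (bilin_comp (bilinC bf) (par_linear GA b) (par_linear GB b')).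
Qed.

Lemma kflip_hom (A B : vectType F) (GA : grading A) (GB : grading B)
    (T : lmodType F) (f : B -> A -> T) d d' x y :
  bilin f -> homog GA d x -> homog GB d' y ->
  kflip GA GB f x y = (-1) ^+ (odd `|d|%N && odd `|d'|%N) *: f y x.
Proof.
move=> [f1 f2] hx hy; rewrite /kflip !sum_bool !(par_hom _ hx) !(par_hom _ hy).
by case: (odd `|d|%N); case: (odd `|d'|%N); rewrite /= ?(lin0 (f1 _)) ?(lin0 (f2 _))
  !scaler0 ?addr0 ?add0r.
Qed.

Lemma bracketW_bilin : bilin (bracketW GV GM q act).
Proof.
have [q1 q2] := lie_bilin lie_q; have [a1 a2] := act_bilin mod_act.
have [k1 k2] := kflip_bilin GM GV (act_bilin mod_act).
split=> [w a x y|y a w z]; rewrite /bracketW /=.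
  congr (_, _); first exact: q1.
  by rewrite /= a1 k1 opprD addrACA scalerBr.
congr (_, _); first exact: q2.
by rewrite /= a2 k2 opprD addrACA scalerBr.
Qed.

Lemma coadj_fun_lin1 f z : linear (fun w => coadj_fun GV GM q act w f z).
Proof.
have [b1 b2] := bracketW_bilin; have [e1 e2] := @evW_bilin F V M.
move=> a x y; rewrite /coadj_fun scaler_sumr -big_split; apply: eq_bigr => b _.
rewrite scaler_sumr -big_split; apply: eq_bigr => c _.
rewrite scaler_sumr -big_split; apply: eq_bigr => d _.
by rewrite par_linear b1 e1 scalerDr !scalerA [a * _]mulrC.
Qed.

Lemma coadj_fun_lin2 w z : linear (fun f => coadj_fun GV GM q act w f z).
Proof.
have [e1 e2] := @evW_bilin F V M.
move=> a x y; rewrite /coadj_fun scaler_sumr -big_split; apply: eq_bigr => b _.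
rewrite scaler_sumr -big_split; apply: eq_bigr => c _.
rewrite scaler_sumr -big_split; apply: eq_bigr => d _.
by rewrite par_linear e2 scalerDr !scalerA [a * _]mulrC.
Qed.

Lemma coadj_fun_lin3 w f : linear (coadj_fun GV GM q act w f).
Proof.
have [b1 b2] := bracketW_bilin; have [e1 e2] := @evW_bilin F V M.
move=> a x y; rewrite /coadj_fun scaler_sumr -big_split; apply: eq_bigr => b _.
rewrite scaler_sumr -big_split; apply: eq_bigr => c _.
rewrite scaler_sumr -big_split; apply: eq_bigr => d _.
by rewrite par_linear b2 e1 scalerDr !scalerA [a * _]mulrC.
Qed.

Lemma coadj_fstE w f y : (coadj GV GM q act w f).1 y = coadj_fun GV GM q act w f (y, 0).
Proof.
rewrite linfunE' // => a x z; rewrite -coadj_fun_lin3; congr coadj_fun.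
by congr (_, _); rewrite /= scaler0 addr0.
Qed.

Lemma coadj_sndE w f y : (coadj GV GM q act w f).2 y = coadj_fun GV GM q act w f (0, y).
Proof.
rewrite linfunE' // => a x z; rewrite -coadj_fun_lin3; congr coadj_fun.
by congr (_, _); rewrite /= scaler0 addr0.
Qed.

Lemma coadj_bilin : bilin (coadj GV GM q act).
Proof.
split=> [w a x y|y a w z]; rewrite [LHS]surjective_pairing [RHS]surjective_pairing;
  congr (_, _); apply/lfunP => v;
  rewrite ?add_lfunE ?scale_lfunE ?coadj_fstE ?coadj_sndE.
- exact: coadj_fun_lin2.
- exact: coadj_fun_lin2.
- exact: (coadj_fun_lin1 y (v, 0)).
- exact: (coadj_fun_lin1 y (0, v)).
Qed.

Lemma qt_bilin : bilin (qt GV GM q act).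
Proof.
have [b1 b2] := bracketW_bilin; have [c1 c2] := coadj_bilin.
have [k1 k2] := kflip_bilin GW' GW coadj_bilin.
split=> [w a x y|y a w z]; rewrite /qt /=.
  congr (_, _); first exact: b1.
  by rewrite /= c1 k1 opprD addrACA scalerBr.
congr (_, _); first exact: b2.
by rewrite /= c2 k2 opprD addrACA scalerBr.
Qed.

Definition shqt (x y : D) : D := \sum_(b : bool) (-1) ^+ b *: qt GV GM q act (dpar GD b x) y.

Lemma shqt_bilin : bilin shqt.
Proof. exact: bilin_twist qt_bilin. Qed.

Lemma shqtE d x y : homog GD d x -> shqt x y = (-1) ^+ dpr d *: qt GV GM q act x y.
Proof. by move=> hx; apply: (dpar_collapse _ (qt_bilin.2 y) hx). Qed.

Lemma shqt_fst x y : (shqt x y).1.1 = shq GV q x.1.1 y.1.1.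
Proof. by rewrite /shqt /shq !sum_bool /= !dpar_fstfst. Qed.

Lemma bilin_multi2 (T : lmodType F) (B : D -> D -> T) :
  bilin B -> multilinear (fun v : {ffun 'I_2 -> D} => B (v ord0) (v ord_max)).
Proof.
move=> [B1 B2] u i a x y; case: (unliftP ord0 i) => [j ->|->].
  have -> : lift ord0 j = ord_max by rewrite ord1; apply: val_inj.
  by rewrite !ffunE /= B1.
by rewrite !ffunE /= B2.
Qed.

Lemma QtE v : Qt GV GM q act v = shqt (v ord0) (v ord_max).
Proof.
have m1 := bilin_multi2 qt_bilin.
move: v; apply: (multi_ext (G := GD)) => [||d u hu].
- exact: shift_multi.
- exact: bilin_multi2 shqt_bilin.
rewrite /Qt (shiftE m1 hu) (shqtE _ (hu ord0)) /wt big_ord_recl big_ord1 /=.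
by rewrite mul1n mul0n addn0 oddb ffunE.
Qed.

(** The sign |w||a| occurs twice, in the coadjoint action and in the bracket of [a] with [w], so
    that only |w||f| remains. *)
Lemma coadj_snd_hom d e i w f a :
  homog GW d w -> homog GW' e f -> homog GM i a ->
  (coadj GV GM q act w f).2 a
  = - ((-1) ^+ (odd `|d|%N && odd `|e|%N) *: f.2 (act w.1 a)).
Proof.
move=> hw hf ha; have [b1 b2] := bracketW_bilin; have [e1 e2] := @evW_bilin F V M.
have ha' : homog GW i ((0, a) : V * M) by apply: homog_prod => //; apply: homog0.
have -> : (coadj GV GM q act w f).2 a =
    (-1) ^+ (odd `|d|%N && (odd `|e|%N (+) odd `|i|%N)) *:
    evW f (bracketW GV GM q act (0, a) w).
  rewrite coadj_sndE /coadj_fun !sum_bool !(par_hom _ hw) !(par_hom _ hf) !(par_hom _ ha').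
  case: (odd `|d|%N); case: (odd `|e|%N); case: (odd `|i|%N);
  by rewrite /= ?(lin0 (b1 _)) ?(lin0 (b2 _)) ?(lin0 (e1 _)) ?(lin0 (e2 _))
    !scaler0 ?addr0 ?add0r.
have [a1 a2] := act_bilin mod_act; have [q1 q2] := lie_bilin lie_q.
rewrite /bracketW /evW /= (kflip_hom (act_bilin mod_act) ha (homog_fst hw)).
rewrite (lin0 (a2 _)) (lin0 (q2 _)) linear0 add0r sub0r linearN linearZ /= scalerN.
rewrite scalerA -signr_addb; congr (- ((-1) ^+ nat_of_bool _ *: _)).
by case: (odd `|d|%N); case: (odd `|e|%N); case: (odd `|i|%N).
Qed.

Lemma evM_shqt d0 d1 i u0 u1 a :
  homog GD d0 u0 -> homog GD d1 u1 -> homog GM i a ->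
  evM (shqt u0 u1) a =
    (-1) ^+ (dpr d0) *: evM u0 (act u1.1.1 a)
    - (-1) ^+ (dpr d0 (+) (odd `|d0|%N && odd `|d1|%N)) *: evM u1 (act u0.1.1 a).
Proof.
move=> h0 h1 ha; rewrite (shqtE _ h0) (linZ _ _ ((@evM_bilin F V M).2 a)).
rewrite /evM /qt /= add_lfunE opp_lfunE.
rewrite (kflip_hom coadj_bilin (homog_snd h0) (homog_fst h1)) /= scale_lfunE.
rewrite (coadj_snd_hom (homog_fst h0) (homog_snd h1) ha).
rewrite (coadj_snd_hom (homog_fst h1) (homog_snd h0) ha).
rewrite scalerDr !scalerN opprK !scalerA addrC signr_addb.
by rewrite [odd `|d1|%N && _]andbC -mulrA -expr2 sqrr_sign mulr1.
Qed.

Section Contraction.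
Variables (N : nat) (e e' : N.-tuple D).
Hypothesis basis_e : basis_of fullv e.
Hypothesis dual_e : forall i j : 'I_N, bt GV GM (tnth e i) (tnth e' j) = (i == j)%:R.

Lemma sum_dual z : \sum_i bt GV GM (tnth e i) z *: tnth e' i = z.
Proof.
have [b1 b2] := bt_bilin GV GM.
apply/eqP; rewrite -subr_eq0; apply/eqP; apply: (@bt_nondeg _ _ _ GV GM) => u.
rewrite (coord_basis basis_e (memvf u)) (lin_sum _ _ _ (b2 _)) big1 // => j _.
rewrite (linZ _ _ (b2 _)) -tnth_nth (linD _ _ (b1 _)) (linN _ (b1 _)).
rewrite (lin_sum _ _ _ (b1 _)) (bigD1 j) //= big1 => [|i ij].
  by rewrite (linZ _ _ (b1 _)) dual_e eqxx addr0 [_ *: 1]mulr1 subrr scaler0.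
by rewrite (linZ _ _ (b1 _)) dual_e eq_sym (negPf ij) scaler0.
Qed.

(** The coefficient of a vector z on [tnth e' i] is [bt (tnth e i) z], while [Om] produces
    [Bt z (tnth e i)], its opposite by [BtE]; hence the sign. *)
Lemma contraction m (g : {ffun 'I_m.+1 -> D} -> F^o) v w : multilinear g ->
  \sum_i Om GV GM (Qt GV GM q act) (snocf v (tnth e i)) * g (consf (tnth e' i) w)
  = - g (consf (shqt (v ord0) (v ord_max)) w).
Proof.
move=> mg; have lg := linear_consf w mg.
rewrite -[in RHS](sum_dual (shqt _ _)) (lin_sum _ _ _ lg) -sumrN; apply: eq_bigr => i _.
by rewrite (linZ _ _ lg) /Om initf_snocf snocf_max BtE QtE mulNr.
Qed.
End Contraction.
End QtStructure.

(** * A bracket inserted in the slot of the dual of M *)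

Section Brackets.
Variables (F : fieldType) (V M : vectType F) (GV : grading V) (GM : grading M).
Variables (q : V -> V -> V) (act : V -> M -> M).
Hypothesis lie_q : graded_lie GV q.
Hypothesis mod_act : graded_module GV GM q act.

Local Notation D := (dbl V M).
Local Notation GD := (graddbl GV GM).
Local Notation R := (shqt GV GM q act).
Let dparP := @dparE F D GD.
Let ldpar := dpar_linear GD.
Let bR : bilin R := shqt_bilin lie_q mod_act.

Lemma homog_xpart k (d : {ffun 'I_k -> int}) (u : {ffun 'I_k -> D}) :
  (forall i, homog GD (d i) (u i)) -> forall i, homog GV (d i) (xpart u i).
Proof. by move=> hu i; rewrite ffunE; exact: homog_fst (homog_fst (hu i)). Qed.

(** The sign uses the degree of the value of [C] instead of that of [w]: the parities agree whenever
    the pairing is nonzero. It is thus linear in [w], into which a bracket can be substituted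
    without tracking its degree. *)
Lemma pact_ext_first k (C : {ffun 'I_k -> V} -> M) (d : {ffun 'I_k -> int})
    (v : {ffun 'I_k -> D}) w e :
  multilinear C -> (forall i, homog GD (d i) (v i)) ->
  homog GM e (C (xpart v)) ->
  pact (dpar GD) (lift_perm ord_max ord0 1) (ext C) (consf w v)
  = (-1) ^+ (dpr e && btot (hpr dpr d)) *: evM w (C (xpart v)).
Proof.
move=> mC hv hC; have mE := ext_multi mC.
have l1 := linear_consf v (pact_multi ldpar (lift_perm ord_max ord0 1) mE).
have [e1 e2] := @evM_bilin F V M.
move: w; apply: (linear_homog (G := GD) l1) => [a x y|i w hw].
  by rewrite e2 scalerDr !scalerA mulrC.
pose d' : {ffun 'I_k.+1 -> int} := [ffun j => oapp d i (unlift ord0 j)].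
have hd j : homog GD (d' j) (consf w v j).
  by rewrite !ffunE; case: unliftP => [l _|_] /=; [apply: hv | apply: hw].
rewrite (pactE dparP _ mE hd) kz_liftm0 -hpr_liftf.
rewrite (_ : liftf ord0 d' = d); last by apply/ffunP => l; rewrite !ffunE liftK.
have -> : ext C (permf (lift_perm ord_max ord0 1) (consf w v)) = evM w (C (xpart v)).
  rewrite /ext ffunE lift_perm_id consf0; congr (evM _ (C _)).
  by apply/ffunP => l; rewrite !ffunE lift_perm_lift perm1 liftK.
rewrite !ffunE unlift_none /=; case: (eqVneq e (- i)) => [->|ne].
  by rewrite /dpr abszN.
by rewrite /evM (dual_homog (homog_snd (homog_snd hw)) hC ne) !scaler0.
Qed.

Section Cochain.
Variables (k : nat) (p : int) (c : {ffun 'I_k -> V} -> M).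
Hypothesis mc : multilinear c.
Hypothesis dc : has_degree GV GM c p.
Let C := shift GV c.
Let mC : multilinear C := shift_multi GV mc.

(* Up to sign the form h_0(x_1 . C(x_2, ...)), where C has shifted degree p + k - 1. *)
Definition actfR (u : {ffun 'I_k.+2 -> D}) : F^o :=
  (-1) ^+ k *: pact (dpar GD) (lift_perm ord_max ord0 1) (ext (actf GV act p C)) u.

Lemma actfR_multi : multilinear actfR.
Proof. by apply/multiZ/(pact_multi ldpar)/ext_multi/(actf_multi mod_act). Qed.

Lemma actfR_hom (d : {ffun 'I_k.+2 -> int}) (u : {ffun 'I_k.+2 -> D}) :
  (forall i, homog GD (d i) (u i)) ->
  let eps := hpr dpr d in
  actfR u = (-1) ^+ (odd k (+) (eps ord0 && btot (liftf ord0 eps))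
      (+) odd `|p|%N (+) (eps (lift ord0 ord0) && (odd `|p|%N (+) odd k)))
    *: evM (u ord0) (act (u (lift ord0 ord0)).1.1 (C (xpart (liftf ord0 (liftf ord0 u))))).
Proof.
move=> hu eps; have ma := actf_multi mod_act p mC.
have mE : multilinear (ext (actf GV act p C)) := ext_multi ma.
rewrite /actfR (pactE dparP _ mE hu) kz_liftm0 -/eps -[_ ^+ k]signr_odd.
rewrite /ext /actf.
have -> : permf (lift_perm ord_max ord0 1) u ord_max = u ord0 by rewrite ffunE lift_perm_id.
have hx := homog_fst (homog_fst (hu (lift ord0 ord0))).
have -> : xpart (liftf ord_max (permf (lift_perm ord_max ord0 1) u)) ord0
    = (u (lift ord0 ord0)).1.1.
  by rewrite !ffunE lift_perm_lift perm1.
have -> : liftf ord0 (xpart (liftf ord_max (permf (lift_perm ord_max ord0 1) u)))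
    = xpart (liftf ord0 (liftf ord0 u)).
  by apply/ffunP => l; rewrite !ffunE lift_perm_lift perm1.
rewrite (actCE mod_act _ _ _ hx) (linZ _ _ ((@evM_bilin F V M).1 _)) !scalerA -!signr_addb.
by congr ((-1) ^+ _ *: _); rewrite !ffunE !addbA.
Qed.

Lemma evM_parity d0 d1 e (u0 u1 : D) a :
  homog GD d0 u0 -> homog GD d1 u1 -> homog GM e a ->
  odd `|d0|%N != odd `|d1|%N (+) odd `|e|%N -> evM u0 (act u1.1.1 a) = 0.
Proof.
move=> h0 h1 ha ne.
have hact := act_degree mod_act (homog_fst (homog_fst h1)) ha.
apply: (dual_homog (homog_snd (homog_snd h0)) hact).
by apply: contra ne => /eqP E; rewrite -odd_absD E abszN.
Qed.

(* The bracket of the first two letters fills the M*-slot, which leaves the terms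
   h_0(x_1 . a) and h_1(x_0 . a). Their signs are those of actfR only because
   h(x . a) vanishes unless |h| = |x| + |a| modulo 2. *)
Lemma first_term u :
  pact (dpar GD) (lift_perm ord_max ord0 1) (ext C) (cons2f R u)
  = actfR u + pact (dpar GD) (swap01 k) actfR u.
Proof.
have mE : multilinear (ext C) := ext_multi mC.
move: u; apply: (multi_ext (G := GD)) => [||d u hu].
- exact: multi_cons2f bR (pact_multi ldpar _ mE).
- exact: multiD actfR_multi (pact_multi ldpar _ actfR_multi).
have hv := homog_liftf ord0 (homog_liftf ord0 hu).
set v := liftf ord0 (liftf ord0 u) in hv *.
set d2 := liftf ord0 (liftf ord0 d) in hv.
have hC : homog GM (\sum_i d2 i + p) (C (xpart v)).
  exact: (shift_degree mc dc (homog_xpart hv)).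
rewrite /cons2f (pact_ext_first _ mC hv hC).
rewrite (evM_shqt lie_q mod_act (hu ord0) (hu _) hC).
rewrite (pactE dparP _ actfR_multi hu) kz_swap01 (actfR_hom hu).
rewrite (actfR_hom (d := permf (swap01 k) d)); last by move=> i; rewrite !ffunE.
have s0 (A : Type) (z : {ffun 'I_k.+2 -> A}) : permf (swap01 k) z ord0 = z (lift ord0 ord0).
  by rewrite ffunE lift_perm_id.
have s1 (A : Type) (z : {ffun 'I_k.+2 -> A}) : permf (swap01 k) z (lift ord0 ord0) = z ord0.
  by rewrite ffunE lift_perm_lift perm1; congr (z _); apply: val_inj.
have s2 (A : Type) (z : {ffun 'I_k.+2 -> A}) :
    liftf ord0 (liftf ord0 (permf (swap01 k) z)) = liftf ord0 (liftf ord0 z).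
  apply/ffunP => l; rewrite !ffunE lift_perm_lift perm1; congr (z _).
  exact: val_inj.
rewrite !hpr_permf !s0 !s1 s2 -/v.
have bt (z : {ffun 'I_k.+1 -> bool}) : btot z = z ord0 (+) btot (liftf ord0 z).
  by rewrite /btot big_ord_recl; congr (_ (+) _); apply: eq_bigr => l _; rewrite ffunE.
rewrite !bt s2 -!hpr_liftf -/d2.
have -> : liftf ord0 (permf (swap01 k) (hpr dpr d)) ord0 = hpr dpr d ord0.
  by rewrite ffunE s1.
set E := btot (hpr dpr d2).
(* Each of the k letters has |x| = deg x + 1 modulo 2, whence [odd k]. *)
have hA : odd `|(\sum_i d2 i + p)%R|%N = odd k (+) E (+) odd `|p|%N.
  rewrite odd_absD odd_abs_sum; congr (_ (+) _).
  have -> : odd k = \big[addb/false]_(l < k) true.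
    by rewrite -odd_sumb /= sum1_card card_ord.
  rewrite /E /btot -big_split; apply: eq_bigr => l _.
  by rewrite !ffunE /dpr /= negbK.
have := evM_parity (hu ord0) (hu (lift ord0 ord0)) hC.
have := evM_parity (hu (lift ord0 ord0)) (hu ord0) hC.
move: (evM _ _) (evM _ _) => H1 H0.
rewrite hA /dpr hA !ffunE /dpr scalerBr !scalerA -!signr_addb -scaleNr -signrN.
clear hA; clearbody E.
move: (odd `|d ord0|%N) (odd `|d (lift ord0 ord0)|%N) E (odd k) (odd `|p|%N) => o0 o1 b j r.
move=> P1 P0; congr (_ + _).
  case: (eqVneq o0 (o1 (+) (j (+) b (+) r))) P0 => [-> _|_ -> //]; last by rewrite !scaler0.
  by congr ((-1) ^+ nat_of_bool _ *: _); case: o1 b j r {P1} => [] [] [] [].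
case: (eqVneq o1 (o0 (+) (j (+) b (+) r))) P1 => [-> _|_ -> //]; last by rewrite !scaler0.
by congr ((-1) ^+ nat_of_bool _ *: _); case: o0 b j r {P0} => [] [] [] [].
Qed.
End Cochain.
End Brackets.

(** * Comparison of the symmetrizations *)

Section Symmetrization.
Variables (F : fieldType) (V M : vectType F) (GV : grading V) (GM : grading M).
Variables (q : V -> V -> V) (act : V -> M -> M).
Hypothesis lie_q : graded_lie GV q.
Hypothesis mod_act : graded_module GV GM q act.

Local Notation D := (dbl V M).
Local Notation GD := (graddbl GV GM).
Local Notation R := (shqt GV GM q act).
Local Notation Sz := (symz (dpar GD)).
Let dparP := @dparE F D GD.
Let ldpar := dpar_linear GD.
Let bR : bilin R := shqt_bilin lie_q mod_act.

Lemma Sym_Cycl n (f : {ffun 'I_n.+1 -> D} -> F^o) u :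
  multilinear f -> Defs.Sym GD (Cycl GD f) u = n.+1%:R *: Defs.Sym GD f u.
Proof.
move=> mf; rewrite -[LHS]/(Sz (Cycl GD f) u) (eq_symz _ (CyclE GV GM f)) symz_sum.
rewrite (eq_bigr (fun=> Sz f u)) => [|i _]; last first.
  exact: (symz_pact ldpar dparP (rot1 n.+1 ^+ i.+1)%g mf u).
by rewrite sumr_const card_ord scaler_nat.
Qed.

Lemma symz_ext_pact k (f : {ffun 'I_k -> V} -> M) (s : 'S_k) u : multilinear f ->
  Sz (ext (pact (dpar GV) s f)) u = Sz (ext f) u.
Proof.
move=> mf; rewrite -(eq_symz _ (pact_ext GV GM s mf)).
exact: (symz_pact ldpar dparP (lift_perm ord_max ord_max s) (ext_multi mf)).
Qed.

Lemma symz_extD k (f g : {ffun 'I_k -> V} -> M) u :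
  Sz (ext (fun v => f v + g v)) u = Sz (ext f) u + Sz (ext g) u.
Proof.
rewrite -symzD; apply: eq_symz => v.
by rewrite /ext (linD _ _ ((@evM_bilin F V M).1 _)).
Qed.

Lemma symz_extZ k (f : {ffun 'I_k -> V} -> M) a u :
  Sz (ext (fun v => a *: f v)) u = a *: Sz (ext f) u.
Proof.
rewrite -symzZ; apply: eq_symz => v.
by rewrite /ext (linZ _ _ ((@evM_bilin F V M).1 _)).
Qed.

Lemma symz_ext_sum k (I : finType) (Q : pred I) (f : I -> {ffun 'I_k -> V} -> M) u :
  Sz (ext (fun v => \sum_(i | Q i) f i v)) u = \sum_(i | Q i) Sz (ext (f i)) u.
Proof.
rewrite -symz_sum; apply: eq_symz => v.
by rewrite /ext (lin_sum _ _ _ ((@evM_bilin F V M).1 _)).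
Qed.

Lemma card_ltn_pairs n : #|[pred p : 'I_n * 'I_n | (p.1 < p.2)%N]| = 'C(n, 2).
Proof.
rewrite -bin2_sum big_mkord -sum1_card.
transitivity (\sum_(j < n) \sum_(i < n | (i < j)%N) 1)%N; last first.
  apply: eq_bigr => j _; rewrite -(big_ord_widen n (fun=> 1%N)) ?(ltnW (ltn_ord j)) //.
  by rewrite sum1_card card_ord.
rewrite pair_big_dep /= [RHS](reindex_inj (h := fun p => (p.2, p.1))) //=.
by move=> [a b] [a' b'] [-> ->].
Qed.

(** The multiplicities are the numbers of cosets: k + 1 letters that may act, and C(k + 1, 2) pairs
    that may be bracketed. *)
Lemma symz_ext_dCh k p (c : {ffun 'I_k -> V} -> M) u : multilinear c ->
  Sz (ext (shift GV (dCh GV q act p c))) u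
  = k.+1%:R *: Sz (ext (actf GV act p (shift GV c))) u
    + ((-1) ^+ k * ('C(k.+1, 2))%:R) *: Sz (ext (brf GV q (shift GV c))) u.
Proof.
move=> mc; have mC := shift_multi GV mc.
rewrite (eq_symz _ (eq_ext (shift_dCh lie_q mod_act p mc))).
rewrite symz_extD symz_extZ symz_ext_sum -scalerA; congr (_ + _ *: _).
  rewrite (eq_bigr (fun=> Sz (ext (actf GV act p (shift GV c))) u)) => [|i _].
    by rewrite sumr_const card_ord scaler_nat.
  exact: symz_ext_pact (actf_multi mod_act _ mC).
case: k c mc mC u => [|n] c mc mC u.
  rewrite scale0r /symz big1 // => s _; rewrite /pact big1 // => e _.
  by rewrite /ext /= (lin0 ((@evM_bilin F V M).1 _)) scaler0.
rewrite symz_ext_sum (eq_bigr (fun=> Sz (ext (brf GV q (shift GV c))) u)) => [|r _]; last first.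
  exact: symz_ext_pact (brf_multi lie_q mC).
by rewrite sumr_const scaler_nat card_ltn_pairs.
Qed.

(** Away from the slot of h only the component in V of the bracket on the double is seen, and this
    is the shifted [q]. *)
Lemma ext_cons2f n (C : {ffun 'I_n.+1 -> V} -> M) (u : {ffun 'I_n.+3 -> D}) :
  ext C (cons2f R u) = ext (brf GV q C) u.
Proof.
rewrite /ext /=; congr (evM _ (C _)).
  rewrite (_ : ord_max = lift ord0 ord_max); last exact: val_inj.
  by rewrite /cons2f consf_lift !ffunE; congr (u _); apply: val_inj.
apply/ffunP => l; rewrite /cons2f !ffunE; case: (unliftP ord0 l) => [j ->|->].
  have -> : lift ord_max (lift ord0 j) = lift ord0 (lift ord_max j) :> 'I_n.+2.
    by apply: val_inj; rewrite /= /bump !leq0n /= !add1n ltnS addnS.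
  rewrite !liftK /= !ffunE; congr (u _).1.1; apply: val_inj.
  by rewrite /= /bump !leq0n /= !add1n !ltnS !addnS.
rewrite (_ : lift ord_max ord0 = ord0); last exact: val_inj.
rewrite !unlift_none /= shqt_fst.
by congr (shq _ _ (u _).1.1 (u _).1.1); apply: val_inj.
Qed.

(** One of the k + 1 rotations puts the bracket in the slot of h; it yields the two equivalent terms
    of [first_term], each with the factor (-1)^k of [actfR]. The k others leave the bracket among
    the arguments of [C]. *)
Lemma psi_cons2f_symz k p (c : {ffun 'I_k -> V} -> M) u :
  cochain GV GM p c ->
  Sz (fun v => psi GV GM (shift GV c) (cons2f R v)) u
  = (2%:R * (-1) ^+ k) *: Sz (ext (actf GV act p (shift GV c))) u
    + k%:R *: Sz (ext (brf GV q (shift GV c))) u.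
Proof.
move=> [mc sc dc]; have mC := shift_multi GV mc; have sC := shift_sym mc sc.
have mE := ext_multi mC; have stab := ext_stab GM mC sC.
pose T (v : {ffun 'I_k.+2 -> D}) :=
  pact (dpar GD) (lift_perm ord_max ord0 1) (ext (shift GV c)) (cons2f R v).
have symT : Sz T u = (2%:R * (-1) ^+ k) *: Sz (ext (actf GV act p (shift GV c))) u.
  rewrite (eq_symz _ (first_term lie_q mod_act mc dc)) symzD.
  have ma := actfR_multi mod_act p mc.
  rewrite (symz_pact ldpar dparP _ ma) -mulr2n -scaler_nat -scalerA; congr (_ *: _).
  rewrite symzZ; congr (_ *: _).
  exact: (symz_pact ldpar dparP (lift_perm ord_max ord0 1) (ext_multi (actf_multi mod_act p mC))).
rewrite -symT {symT}/T {T}; case: k c mc sc dc mC sC mE stab u => [|n] c mc sc dc mC sC mE stab u.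
  rewrite scale0r addr0; apply: eq_symz => v; rewrite /psi big_ord1.
  apply: (pact_coset ldpar dparP mE stab).
  by rewrite rotXS_max lift_perm_id.
pose T (v : {ffun 'I_n.+3 -> D}) :=
  pact (dpar GD) (lift_perm ord_max ord0 1) (ext (shift GV c)) (cons2f R v).
(* [t j] puts the same letter last as the rotation it replaces, which suffices by [pact_coset], but
   it keeps the bracket in front, so that [pact_cons2f] applies. *)
pose t (j : 'I_n.+1) : 'S_n.+2 := lift_perm ord0 ord0 (tperm ord_max j).
have max0 : ord_max = lift ord0 ord_max :> 'I_n.+2 by apply: val_inj.
have tE j : t j ord_max = lift ord0 j.
  by rewrite max0 lift_perm_lift tpermL.
have E : (fun v => psi GV GM (shift GV c) (cons2f R v))
    =1 (fun v => T v + \sum_(j < n.+1) pact (dpar GD) (lift_perm ord0 ord0 (t j))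
          (fun v => ext (shift GV c) (cons2f R v)) v).
  move=> v; rewrite /psi big_ord_recl; congr (_ + _).
    by apply: (pact_coset ldpar dparP mE stab); rewrite (rotXS_max ord0) lift_perm_id.
  apply: eq_bigr => j _.
  rewrite (pact_cons2f ldpar dparP _ bR mE); apply: (pact_coset ldpar dparP mE stab).
  by rewrite (rotXS_max (lift ord0 j)) -tE.
rewrite (eq_symz _ E) symzD; congr (_ + _); rewrite symz_sum.
rewrite (eq_bigr (fun=> Sz (ext (brf GV q (shift GV c))) u)) => [|j _].
  by rewrite sumr_const card_ord scaler_nat.
rewrite (symz_pact ldpar dparP _ (multi_cons2f bR mE)).
by apply: eq_symz => v; apply: ext_cons2f.
Qed.
End Symmetrization.

Lemma regular_scaleM (F : fieldType) (a b : F) (x y : F^o) :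
  (a *: x) * (b *: y) = (a * b) *: (x * y) :> F^o.
Proof. exact: mulrACA. Qed.

Lemma regular_scaleCA (F : fieldType) (a b : F) (x y : F^o) :
  x * (b *: (a *: y)) = a *: (x * (b *: y)) :> F^o.
Proof. exact: etrans (congr1 _ (mulrCA b a y)) (mulrCA x a (b * y)). Qed.

(** * The constants and the commutation with the coboundaries *)

Section Morphism.
Variables (F : fieldType) (V M : vectType F) (GV : grading V) (GM : grading M).
Variables (q : V -> V -> V) (act : V -> M -> M).
Hypothesis charF0 : [pchar F] =i pred0.
Hypothesis lie_q : graded_lie GV q.
Hypothesis mod_act : graded_module GV GM q act.
Variables (N : nat) (e e' : N.-tuple (dbl V M)).
Hypothesis basis_e : basis_of fullv e.
Hypothesis dual_e : forall i j : 'I_N,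
  bt GV GM (tnth e i) (tnth e' j) = (i == j)%:R.

Local Notation D := (dbl V M).
Local Notation GD := (graddbl GV GM).
Local Notation R := (shqt GV GM q act).
Local Notation Sz := (symz (dpar GD)).

(** The factor k + 2 counts the rotations in the cyclic sum of the Pinczon bracket, and the inverse
    factorials normalize [sym_bracket]. The minus signs of [contraction] and [Phi_psi] cancel. *)
Lemma dP_Phi k (c : {ffun 'I_k -> V} -> M) u : multilinear c ->
  dP GV GM q act e e' (Phi GV GM c) u
  = ((k.+2)%:R * (3`!%:R^-1 * (k.+1)`!%:R^-1))
    *: Sz (fun v => psi GV GM (shift GV c) (cons2f R v)) u.
Proof.
move=> mc; have mC := shift_multi GV mc.
have bR := shqt_bilin lie_q mod_act.
pose inner (v : {ffun 'I_k.+2 -> D}) : F^o := \sum_(i < N)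
  (3`!%:R^-1 *: Om GV GM (Qt GV GM q act) (snocf [ffun j : 'I_2 => v (lshift k j)] (tnth e i))) *
  ((k.+1)`!%:R^-1 *: Phi GV GM c (consf (tnth e' i) [ffun j : 'I_k => v (rshift 2 j)])).
have E : inner =1 fun v => (3`!%:R^-1 * (k.+1)`!%:R^-1)
    *: psi GV GM (shift GV c) (cons2f R v).
  move=> v; have := contraction lie_q mod_act basis_e dual_e
    [ffun j : 'I_2 => v (lshift k j)] [ffun j : 'I_k => v (rshift 2 j)] (Phi_multi GV GM mc) => Ec.
  rewrite /inner; under eq_bigr do rewrite regular_scaleM.
  rewrite -scaler_sumr Ec; rewrite (Phi_psi GV GM mc) opprK; congr (_ *: psi _ _ _ _).
  have E0 : [ffun j : 'I_2 => v (lshift k j)] ord0 = v ord0.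
    by rewrite ffunE; congr (v _); apply: val_inj.
  have E1 : [ffun j : 'I_2 => v (lshift k j)] ord_max = v (lift ord0 ord0).
    by rewrite ffunE; congr (v _); apply: val_inj.
  have E2 : [ffun j : 'I_k => v (rshift 2 j)] = liftf ord0 (liftf ord0 v).
    by apply/ffunP => j; rewrite !ffunE; congr (v _); apply: val_inj.
  by rewrite E0 E1 E2.
have mi : multilinear inner.
  move=> v i a x y; rewrite !E.
  exact: (multiZ _ (multi_cons2f bR (psi_multi GV GM mC))).
rewrite -[LHS]/(Defs.Sym GD (Cycl GD inner) u) (Sym_Cycl _ _ _ mi) -scalerA; congr (_ *: _).
by rewrite -symzZ; apply: eq_symz.
Qed.

Lemma natrF_neq0 n : n.+1%:R != 0 :> F.
Proof. by rewrite ((pcharf0P F).1 charF0). Qed.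

Lemma dP_PhiE k p (c : {ffun 'I_k -> V} -> M) u : cochain GV GM p c ->
  dP GV GM q act e e' (Phi GV GM c) u
  = ((-1) ^+ k.+1 * (k.+2)%:R / (3 * k.+1)%N%:R) *: Phi GV GM (dCh GV q act p c) u.
Proof.
move=> cc; have [mc sc dc] := cc; have mC := shift_multi GV mc.
rewrite (dP_Phi _ mc) (psi_cons2f_symz lie_q mod_act _ cc).
have md := dCh_multi lie_q mod_act p mc; have mD := shift_multi GV md.
have sD := shift_dCh_sym lie_q mod_act p mc sc.
(* The form [psi] is symmetric, so its symmetrization is (k + 2)! times itself; being a cyclic sum
   of images of [ext], it also symmetrizes to k + 2 times the symmetrization of [ext]. *)
have ED : psi GV GM (shift GV (dCh GV q act p c)) u
    = ((k.+2)`!%:R^-1 * (k.+2)%:R) *: Sz (ext (shift GV (dCh GV q act p c))) u.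
  have := symz_sym u (psi_sym GM mD sD).
  have := Sym_Cycl GV GM u (ext_multi mD).
  rewrite -[X in X = _]/(Sz _ u) (eq_symz _ (CyclE GV GM _)) -/(psi _ _ _) => -> H.
  rewrite -scalerA H scalerA mulVf ?scale1r //.
  by rewrite -(prednK (fact_gt0 _)) natrF_neq0.
rewrite (Phi_psi GV GM md) ED (symz_ext_dCh lie_q mod_act) //.
move: (Sz _ _) (Sz _ _) => S1 S2.
have C2 : ('C(k.+1, 2))%:R = (k.+1)%:R * k%:R / 2%:R :> F.
  apply: (mulIf (natrF_neq0 1)); rewrite divfK ?natrF_neq0 // -!natrM.
  by rewrite bin2 /= muln2 -[RHS]/((k.+1 * k)%:R); congr _%:R;
    rewrite -[RHS]odd_double_half oddM /= andNb.
have f0 : (k.+1)`!%:R != 0 :> F by rewrite -(prednK (fact_gt0 _)) natrF_neq0.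
rewrite C2 (_ : 3`! = 6)%N // (_ : (k.+2)`! = k.+2 * (k.+1)`!)%N //.
move: (k.+1)`! f0 => f f0; rewrite !natrM exprS.
have n1 : 1 + k%:R != 0 :> F by rewrite nat1r natrF_neq0.
have n2 : 2 + k%:R != 0 :> F by rewrite -(natrD _ 2 k) natrF_neq0.
have n3 := natrF_neq0 1; have n4 := natrF_neq0 2; have n6 := natrF_neq0 5.
have sk : (-1) ^+ k * (-1) ^+ k = 1 :> F by rewrite -expr2 sqrr_sign.
have s0 : (-1) ^+ k != 0 :> F by rewrite signr_eq0.
move: ((-1) ^+ k) sk s0 => s sk s0.
rewrite -scaleNr !scalerDr !scalerA; congr (_ *: _ + _ *: _).
  by field; rewrite ?n1 ?n2 ?n3 ?f0 ?n4 ?n6.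
(* In the bracket term the sign (-1)^k occurs twice on the right and not at all on the left;
   inserting its square makes the identity rational in [s]. *)
rewrite -[LHS]mul1r -sk.
by field; rewrite s0 n1 n2 n3 f0 n4 n6.
Qed.

(** The product of the ratios found in [dP_PhiE] for arities below [k], so that passing from k to k
    + 1 absorbs exactly the ratio in arity k. *)
Definition normC (k : nat) : F :=
  \prod_(j < k) ((3 * j.+1)%N%:R * ((-1) ^+ j.+1 * (j.+2)%:R)^-1)^-1.

Lemma normC_step k :
  normC k.+1 = normC k * ((-1) ^+ k.+1 * (k.+2)%:R / (3 * k.+1)%N%:R).
Proof. by rewrite /normC big_ord_recr /= invf_div. Qed.

Lemma normC_neq0 k : normC k != 0.
Proof.
apply/prodf_neq0 => j _; rewrite invr_eq0 mulf_neq0 ?natrM ?mulf_neq0 ?natrF_neq0 //.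
by rewrite invr_eq0 mulf_neq0 ?signr_eq0 ?natrF_neq0.
Qed.

Lemma dPZ k (f : {ffun 'I_k.+1 -> D} -> F^o) a u :
  dP GV GM q act e e' (fun v => a *: f v) u = a *: dP GV GM q act e e' f u.
Proof.
rewrite /dP /sym_bracket /Defs.Sym -symzZ; apply: eq_symz => v.
rewrite /pbracket /Cycl scaler_sumr; apply: eq_bigr => s _.
rewrite -pactZ; apply: eq_pact => w; rewrite scaler_sumr; apply: eq_bigr => i _.
exact: regular_scaleCA.
Qed.
End Morphism.

(** With the normalization of [sym_bracket], [Phi] commutes with the coboundaries up to an explicit
    nonzero scalar in each arity; the last clause absorbs these scalars by rescaling [Phi] arity by
    arity. *)
Theorem proposition6p5 (F : fieldType) (charF0 : [pchar F] =i pred0)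
  (V M : vectType F) (GV : grading V) (GM : grading M)
  (q : V -> V -> V) (act : V -> M -> M)
  (lie_q : graded_lie GV q) (mod_act : graded_module GV GM q act)
  (N : nat) (e e' : N.-tuple (dbl V M))
  (basis_e : basis_of fullv e)
  (dual_e : forall i j : 'I_N,
     bt GV GM (tnth e i) (tnth e' j) = (i == j)%:R) :
  [/\ forall (k : nat) (p : int) (c : {ffun 'I_k -> V} -> M),
        cochain GV GM p c ->
        [/\ multilinear (tildeC GV GM c),
            has_shifted_degree (graddbl GV GM) (graddbl GV GM)
              (tildeC GV GM c) (p + k%:Z - 1),
            symmetric_shifted (graddbl GV GM) (tildeC GV GM c),
            quadratic GV GM (tildeC GV GM c)
          & Phi GV GM c =1 Cycl (graddbl GV GM) (Om GV GM (Cprime GV c))],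
      forall (k : nat) (p : int) (a : F) (c c' : {ffun 'I_k -> V} -> M),
        cochain GV GM p c -> cochain GV GM p c' ->
        forall u, Phi GV GM (fun x => a *: c x + c' x) u
                  = a *: Phi GV GM c u + Phi GV GM c' u,
      forall (k : nat) (p : int) (c : {ffun 'I_k -> V} -> M),
        cochain GV GM p c ->
        forall u, dP GV GM q act e e' (Phi GV GM c) u
          = ((-1) ^+ k.+1 * (k.+2)%:R / (3 * k.+1)%N%:R)
              *: Phi GV GM (dCh GV q act p c) u
    & exists2 mu : nat -> F, forall k, mu k != 0
        & forall (k : nat) (p : int) (c : {ffun 'I_k -> V} -> M),
        cochain GV GM p c ->
        forall u, dP GV GM q act e e' (fun v => mu k *: Phi GV GM c v) u
          = mu k.+1 *: Phi GV GM (dCh GV q act p c) u].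
Proof.
split.
- move=> k p c [mc sc dc]; split.
  + exact: tildeC_multi.
  + exact: tildeC_degree.
  + exact: tildeC_sym.
  + exact: tildeC_quadratic.
  + by move=> u; apply: Phi_Cycl.
- move=> k p a c c' [mc _ _] [mc' _ _] u.
  have mac : multilinear (fun x => a *: c x + c' x) by exact: multiD (multiZ a mc) mc'.
  have E : ext (M := M) (shift GV (fun x => a *: c x + c' x))
      =1 fun v => a *: ext (shift GV c) v + ext (shift GV c') v.
    move=> v; rewrite /ext -(@evM_bilin F V M).1; congr evM.
    rewrite scaler_sumr -big_split; apply: eq_bigr => b _ /=.
    by rewrite scalerDr !scalerA mulrC.
  rewrite !Phi_psi // /psi scalerN -opprD scaler_sumr -big_split; congr (- _).
  by apply: eq_bigr => i _; rewrite (eq_pact _ _ E) pactD pactZ.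
- by move=> k p c cc u; apply: dP_PhiE.
exists (normC F) => [k|k p c cc u]; first exact: normC_neq0.
rewrite dPZ (dP_PhiE charF0 lie_q mod_act basis_e dual_e _ cc) scalerA.
by rewrite -normC_step.
Qed.
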